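(* Let $E$ be a universally complete vector lattice, regarded as an $f$-algebra with multiplicative unit $e$. Let $c\in E$, let $(a_n)_{n\ge 0}$ be a sequence in $E$, and let $$f(x):=\sum_{n=0}^\infty a_n(x-c)^n\quad\text{and}\quad g(x):=\sum_{n=0}^\infty\tfrac{1}{n+1}a_n(x-c)^{n+1},$$ with the same radius of convergence $\rho$, and suppose that $\rho$ dominates a positive invertible element of $E$. For $a,b\in(c-\rho,c+\rho)\cap E$, we have that $f$ is integrable on $[a\wedge b,a\vee b]$ and $$\int_a^b f(x)\,dx=g(b)-g(a).$$
   Context: Universally complete: Dedekind complete and every nonempty pairwise disjoint set of positive elements has a supremum. Order intervals: $[p,q]=\{x\in E:p\le x\le q\}$. Convergence of series is order convergence of partial sums; $f$ and $g$ are defined at the points of $E$ where their series converge in order. It is known that the two series always have the same radius of convergence. Sup-completion. A cone is a commutative monoid with a scalar multiplication by $\mathbb{R}^+=[0,\infty)$ satisfying the usual axioms ($\lambda(x+y)=\lambda x+\lambda y$, $(\lambda+\mu)x=\lambda x+\mu x$, $\lambda(\mu x)=(\lambda\mu)x$, $1x=x$, $0x=0$); a lattice cone is a cone with a lattice order compatible with addition and with multiplication by $\mathbb{R}^+$. The sup-completion $E^s$ is the essentially unique lattice cone $C$ such that: nonempty subsets of $C$ bounded above (below) have suprema (infima); $E$ is the set of additively invertible elements of $C$, with coinciding structures; $y=\sup\{x\in E: x\le y\}$ for $y\in C$; $z+(x\wedge y)=(z+x)\wedge(z+y)$ for $x\in E$, $y,z\in C$; $x\in E$, $y\in C$, $y\le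 x$ imply $y\in E$; $C$ has a largest element; and $\sup A=\sup B$ for nonempty $A,B\subseteq C$ implies $\sup(A\wedge x)=\sup(B\wedge x)$ for all $x\in E$. Sup-inf-completion. $E^{si}=\{(x,y)\in E^s_+\times E^s_+ : x\wedge y=0\}$ ($E^s_+=\{x\in E^s:x\ge0\}$) with $\lambda(x,y)=(\lambda x,\lambda y)$, $-\lambda(x,y)=(\lambda y,\lambda x)$ for $\lambda\in\mathbb{R}^+$, ordered by $(x,y)\le(z,w)$ iff $x\le z$ and $w\le y$. Each $x\in E^s$ is identified with $(x\vee0,-(x\wedge0))$. For $s\in E^{si}$: $s^+=s\vee 0$, $s^-=-(s\wedge0)$; for $0\le u\in E^{si}$, $[u]^{\leq}_+=\{x\in E^+:x\le u\}$. Radius of convergence. For a power series $\sum a_n(x-c)^n$, let $\Omega$ (the spectrum of convergence) be the set of $r\in E^+$ such that the series converges uniformly in order on $[c-r,c+r]$, i.e. it converges there to a function $h$ and there is a sequence $p_m\downarrow0$ in $E$ with $|\sum_{n=0}^m a_n(x-c)^n-h(x)|\le p_m$ for all $m$ and all $x\in[c-r,c+r]$. The radius of convergence is $\rho:=\sup\Omega\in E^s$. ''$\rho$ dominates $s$'' means $s\le\rho$. $c+\rho$ is computed in $E^s$ and $c-\rho:=-(\rho+(-c))\in E^{si}$. Relation $\ll$ on $E^{si}$. For $s\in E^{si}$ put $s_{\pm\infty}=\sup_{m\in\mathbb{N}}\frac1m\inf_{n\in\mathbb{N}}\frac1n s$, $s_{+\infty}=(s_{\pm\infty})^+$, $s_{-\infty}=-(s_{\pm\infty})^-$,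 and $s_{\mathcal F}=\sup\{\inf\{x-x\wedge s_{+\infty}-(y-y\wedge(-s_{-\infty})):y\in[s^-]^{\leq}_+\}:x\in[s^+]^{\leq}_+\}$, which lies in $E$ because $E$ is universally complete. For $0\le u\in E^s$, $B_u$ is the band of $E$ whose band projection is $\mathbb{P}_u(x)=\sup_n(x\wedge nu)$ for $x\in E^+$; for $s\in E^{si}$, $\mathbb{P}_s:=\mathbb{P}_{|s|}$, $B_s:=B_{|s|}$ with $|s|=s\vee(-s)$; $\mathbb{P}^d_s$ is the band projection onto the disjoint complement $B_s^d$. Then $s\ll t$ means $s_{+\infty}=t_{-\infty}=0$ and $\mathbb{P}^d_{s_{-\infty}}\mathbb{P}^d_{t_{+\infty}}(t_{\mathcal F}-s_{\mathcal F})$ is a weak order unit of $B^d_{s_{-\infty}}\cap B^d_{t_{+\infty}}$. For $x\in E$, $x\in(c-\rho,c+\rho)$ means $c-\rho\ll x\ll c+\rho$. Riemann integral. A function $h$ from a subset of $E$ to $E$ is locally band preserving if $\mathbb{P}(x)=\mathbb{P}(y)$ implies $\mathbb{P}(h(x))=\mathbb{P}(h(y))$ for all $x,y\in\mathrm{dom}(h)$ and all band projections $\mathbb{P}$ of $E$; it is order bounded if there is $M\in E^+$ with $|h(x)|\le M$ for all $x$. For $p\le q$ in $E$ and $h:[p,q]\to E$ locally band preserving and order bounded, a partition is a finite chain $P=\{p=x_0\le\dots\le x_n=q\}$, $L(h,P)=\sum_i(\inf_{[x_{i-1},x_i]}h)(x_i-x_{i-1})$, $U(h,P)=\sum_i(\sup_{[x_{i-1},x_i]}h)(x_i-x_{i-1})$;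 $h$ is integrable on $[p,q]$ if $\sup_PL(h,P)=\inf_PU(h,P)$, and this common value is $\int_p^qh(x)\,dx$. For arbitrary $a,b\in E$, $\int_a^bh(x)\,dx:=\mathbb{P}_{a<b}\big(\int_{a\wedge b}^{a\vee b}h(x)\,dx\big)-\mathbb{P}_{b<a}\big(\int_{a\wedge b}^{a\vee b}h(x)\,dx\big)$, where $\mathbb{P}_{a<b}$ is the band projection onto the band generated by $(b-a)^+$. *)

(* Defs.v *)
From HB Require Import structures.
From mathcomp Require Import all_boot all_order all_algebra.
From mathcomp Require Import all_classical all_reals.

Set Implicit Arguments.
Unset Strict Implicit.
Unset Printing Implicit Defensive.

Import Order.TTheory GRing.Theory Num.Theory.
Local Open Scope classical_set_scope.
Local Open Scope ring_scope.

(* HB has no room for a new join of GRing.Zmodule and Order.Lattice below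
   Num.RealDomain (nor of GRing.Lmodule and GRing.PzRing below GRing.Lalgebra),
   so the lattice operations, and the product of an f-algebra, are fields of
   the mixins. *)
HB.mixin Record isVectorLattice (R : realType) V
    of GRing.Lmodule R V & Num.POrderedZmodule V := {
  vmeet : V -> V -> V;
  vjoin : V -> V -> V;
  le_vmeet : forall x y z : V, (z <= vmeet x y) = (z <= x) && (z <= y);
  le_vjoin : forall x y z : V, (vjoin x y <= z) = (x <= z) && (y <= z);
  vle_add : forall x y z : V, x <= y -> z + x <= z + y;
  vle_scale : forall (k : R) (x y : V), 0 <= k -> x <= y -> k *: x <= k *: y
}.

#[short(type="vectorLatticeType")]
HB.structure Definition VectorLattice (R : realType) :=
  {V of GRing.Lmodule R V & Num.POrderedZmodule V & isVectorLattice R V}.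

(* fone = 0 is not excluded, so that the zero space is an f-algebra. *)
HB.mixin Record isFAlgebra (R : realType) V of VectorLattice R V := {
  fmul : V -> V -> V;
  fone : V;
  fmulA : associative fmul;
  fmulDl : left_distributive fmul +%R;
  fmulDr : right_distributive fmul +%R;
  fmulZl : forall (k : R) (x y : V), fmul (k *: x) y = k *: fmul x y;
  fmulZr : forall (k : R) (x y : V), fmul x (k *: y) = k *: fmul x y;
  fmul1l : left_id fone fmul;
  fmul1r : right_id fone fmul;
  fmul_ge0 : forall x y : V, 0 <= x -> 0 <= y -> 0 <= fmul x y;
  fmul_disjl : forall x y z : V, vmeet x y = 0 -> 0 <= z ->
    vmeet (fmul z x) y = 0;
  fmul_disjr : forall x y z : V, vmeet x y = 0 -> 0 <= z ->
    vmeet (fmul x z) y = 0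
}.

#[short(type="fAlgebraType")]
HB.structure Definition FAlgebra (R : realType) :=
  {V of VectorLattice R V & isFAlgebra R V}.

Notation "x ** y" := (fmul x y)
  (at level 40, left associativity) : ring_scope.

Section VectorLatticeTheory.
Variables (R : realType) (E : vectorLatticeType R).
Implicit Types (x y : E) (A B : set E).

Definition vpos x : E := vjoin x 0.
Definition vneg x : E := vjoin (- x) 0.
Definition vabs x : E := vjoin x (- x).

Definition universally_complete :=
  (forall A, A !=set0 -> has_ubound A -> supremums A !=set0) /\
  (forall A, A !=set0 -> (forall x, A x -> 0 <= x) ->
     (forall x y, A x -> A y -> x <> y -> vmeet x y = 0) ->
     supremums A !=set0).

Definition disj_compl A : set E :=
  [set x | forall y, A y -> vmeet (vabs x) (vabs y) = 0].

Definition is_band B :=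
  [/\ B 0,
      forall x y, B x -> B y -> B (x + y),
      forall (k : R) x, B x -> B (k *: x),
      forall x y, B y -> vabs x <= vabs y -> B x &
      forall A x, A `<=` B -> supremums A x -> B x].

Definition band_gen A : set E :=
  [set x | forall B, is_band B -> A `<=` B -> B x].

Definition is_band_projection (P : E -> E) :=
  exists2 B, is_band B & forall x, B (P x) /\ disj_compl B (x - P x).

(* The component of x in B, relative to E = B (+) B^d. *)
Definition band_proj B x : E :=
  xget 0 [set y | B y /\ disj_compl B (x - y)].

Definition weak_order_unit_of B (w : E) :=
  [/\ B w, 0 <= w & forall x, B x -> 0 <= x -> vmeet x w = 0 -> x = 0].

Definition decreases_to0 (p : nat -> E) :=
  (forall m, p m.+1 <= p m) /\ infimums (range p) 0.

Definition order_cvg (u : nat -> E) (l : E) :=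
  exists2 p : nat -> E, decreases_to0 p & forall m, vabs (u m - l) <= p m.

Definition partial_sum (u : nat -> E -> E) (m : nat) x : E :=
  \sum_(n < m.+1) u n x.

Definition series_dom (u : nat -> E -> E) : set E :=
  [set x | exists l, order_cvg (fun m => partial_sum u m x) l].

(* Meaningful on series_dom u only; 0 elsewhere. *)
Definition series_fun (u : nat -> E -> E) x : E :=
  xget 0 [set l | order_cvg (fun m => partial_sum u m x) l].

Definition spectrum_cvg (u : nat -> E -> E) (c : E) : set E :=
  [set r | 0 <= r /\ exists h : E -> E, exists2 p : nat -> E,
     decreases_to0 p &
     forall m x, x \in `[c - r, c + r] ->
       vabs (partial_sum u m x - h x) <= p m].

Definition locally_band_preserving (D : set E) (h : E -> E) :=
  forall P, is_band_projection P ->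
  forall x y, D x -> D y -> P x = P y -> P (h x) = P (h y).

Definition order_bounded (D : set E) (h : E -> E) :=
  exists2 M, 0 <= M & forall x, D x -> vabs (h x) <= M.

End VectorLatticeTheory.

Section FAlgebraTheory.
Variables (R : realType) (E : fAlgebraType R).

Definition fexp (x : E) (n : nat) : E := iter n (fmul x) fone.

Definition finvertible (x : E) := exists y, x ** y = fone /\ y ** x = fone.

Definition power_series (c : E) (a : nat -> E) (n : nat) (x : E) : E :=
  a n ** fexp (x - c) n.

Definition integrated_power_series (c : E) (a : nat -> E) (n : nat) (x : E) : E :=
  (n.+1%:R^-1 *: a n) ** fexp (x - c) n.+1.

(* The chain p = x_0 <= ... <= x_n = q is encoded by the sequence
   s = [:: x_1; ...; x_n]. *)
Definition is_partition (p q : E) (s : seq E) :=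
  path <=%R p s && (last p s == q).

Definition lower_sum (h : E -> E) (p : E) (s : seq E) : E :=
  \sum_(i < size s)
    infimum 0 (h @` `[nth 0 (p :: s) i, nth 0 s i]%classic)
      ** (nth 0 s i - nth 0 (p :: s) i).

Definition upper_sum (h : E -> E) (p : E) (s : seq E) : E :=
  \sum_(i < size s)
    supremum 0 (h @` `[nth 0 (p :: s) i, nth 0 s i]%classic)
      ** (nth 0 s i - nth 0 (p :: s) i).

Definition lower_sums (h : E -> E) (p q : E) : set E :=
  [set lower_sum h p s | s in [set s | is_partition p q s]].

Definition upper_sums (h : E -> E) (p q : E) : set E :=
  [set upper_sum h p s | s in [set s | is_partition p q s]].

Definition riemann_integrable (D : set E) (h : E -> E) (p q : E) :=
  [/\ p <= q,
      `[p, q]%classic `<=` D,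
      locally_band_preserving `[p, q]%classic h,
      order_bounded `[p, q]%classic h &
      exists2 I, supremums (lower_sums h p q) I
               & infimums (upper_sums h p q) I].

Definition ordered_integral (h : E -> E) (p q : E) : E :=
  supremum 0 (lower_sums h p q).

Definition proj_lt (a b : E) : E -> E :=
  band_proj (band_gen [set vpos (b - a)]).

Definition riemann_integral (h : E -> E) (a b : E) : E :=
  let I := ordered_integral h (vmeet a b) (vjoin a b) in
  proj_lt a b I - proj_lt b a I.

End FAlgebraTheory.

(* cscale is only meaningful for nonnegative scalars. *)
HB.mixin Record isLatticeCone (R : realType) C of Order.Lattice ring_display C := {
  czero : C;
  cadd : C -> C -> C;
  cscale : R -> C -> C;
  caddA : associative cadd;
  caddC : commutative cadd;
  cadd0l : left_id czero cadd;
  cscaleDr : forall k x y, 0 <= k ->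
    cscale k (cadd x y) = cadd (cscale k x) (cscale k y);
  cscaleDl : forall k l x, 0 <= k -> 0 <= l ->
    cscale (k + l) x = cadd (cscale k x) (cscale l x);
  cscaleA : forall k l x, 0 <= k -> 0 <= l ->
    cscale k (cscale l x) = cscale (k * l) x;
  cscale1 : forall x, cscale 1 x = x;
  cscale0 : forall x, cscale 0 x = czero;
  cle_add : forall x y z : C, x <= y -> cadd z x <= cadd z y;
  cle_scale : forall k (x y : C), 0 <= k -> x <= y -> cscale k x <= cscale k y
}.

#[short(type="latticeConeType")]
HB.structure Definition LatticeCone (R : realType) :=
  {C of Order.Lattice ring_display C & isLatticeCone R C}.

Notation "x +c y" := (cadd x y) (at level 50, left associativity) : ring_scope.
Notation "k *c x" := (cscale k x) (at level 40, left associativity) : ring_scope.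

Record supCompletion (R : realType) (E : vectorLatticeType R) := SupCompletion {
  sup_cone :> latticeConeType R;
  scincl : E -> sup_cone;
  sc_sup : forall A : set sup_cone,
    A !=set0 -> has_ubound A -> supremums A !=set0;
  sc_inf : forall A : set sup_cone,
    A !=set0 -> has_lbound A -> infimums A !=set0;
  scincl_le : forall x y, (scincl x <= scincl y) = (x <= y);
  scincl_add : forall x y, scincl (x + y) = scincl x +c scincl y;
  scincl_scale : forall (k : R) x, 0 <= k -> scincl (k *: x) = k *c scincl x;
  scincl_meet : forall x y, scincl (vmeet x y) = (scincl x `&` scincl y)%O;
  scincl_join : forall x y, scincl (vjoin x y) = (scincl x `|` scincl y)%O;
  scincl_range : forall y : sup_cone,
    (exists z, y +c z = czero) <-> exists x, scincl x = y;
  scincl_dense : forall y : sup_cone,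
    supremums [set scincl x | x in [set x | scincl x <= y]] y;
  sc_add_meet : forall (x : E) (y z : sup_cone),
    z +c (scincl x `&` y)%O = ((z +c scincl x) `&` (z +c y))%O;
  scincl_lower : forall (x : E) (y : sup_cone),
    y <= scincl x -> exists z, scincl z = y;
  sc_top : exists t : sup_cone, forall y : sup_cone, y <= t;
  sc_meet_sup : forall A B : set sup_cone, A !=set0 -> B !=set0 ->
    supremum czero A = supremum czero B ->
    forall x : E,
      supremum czero [set (y `&` scincl x)%O | y in A] =
      supremum czero [set (y `&` scincl x)%O | y in B]
}.

Section SupInf.
Variables (R : realType) (C : latticeConeType R).

Definition supinf_pred (p : C * C) : bool :=
  [&& czero <= p.1, czero <= p.2 & (p.1 `&` p.2)%O == czero].

Record supInf := SupInf { sipair : C * C; _ : supinf_pred sipair }.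

HB.instance Definition _ := [isSub for sipair].
HB.instance Definition _ := [Choice of supInf by <:].

Definition sile (s t : supInf) : bool :=
  ((sipair s).1 <= (sipair t).1) && ((sipair t).2 <= (sipair s).2).

Lemma sile_refl : reflexive sile.
Proof. by move=> s; rewrite /sile !lexx. Qed.

Lemma sile_anti : antisymmetric sile.
Proof.
move=> [[x y] ?] [[z w] ?]; rewrite /sile /=.
case/andP=> /andP[xz wy] /andP[zx yw]; apply: val_inj => /=.
by congr (_, _); apply: le_anti; apply/andP.
Qed.

Lemma sile_trans : transitive sile.
Proof.
move=> t s u /andP[st1 st2] /andP[tu1 tu2].
by rewrite /sile (le_trans st1 tu1) (le_trans tu2 st2).
Qed.

HB.instance Definition _ :=
  Order.Le_isPOrder.Build ring_display supInf sile_refl sile_anti sile_trans.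

Lemma cscale_r0 (k : R) : 0 <= k -> k *c czero = czero :> C.
Proof.
by move=> k0; rewrite -[X in k *c X](cscale0 czero) cscaleA// mulr0 cscale0.
Qed.

Lemma cscale_disj (k : R) (x y : C) : 0 <= k ->
  (x `&` y)%O = czero -> (k *c x `&` k *c y)%O = czero.
Proof.
rewrite le_eqVlt => /orP[/eqP <- _|k0 xy]; first by rewrite !cscale0 meetxx.
have k0' := ltW k0.
have kV0 : 0 <= k^-1 by rewrite invr_ge0.
have kK (z : C) : k *c (k^-1 *c z) = z.
  by rewrite cscaleA// mulfV ?gt_eqF// cscale1.
have kVK (z : C) : k^-1 *c (k *c z) = z.
  by rewrite cscaleA// mulVf ?gt_eqF// cscale1.
apply: le_anti; apply/andP; split.
  rewrite -[leLHS]kK -(cscale_r0 k0') -xy; apply: cle_scale => //.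
  rewrite lexI; apply/andP; split.
    by rewrite -[leRHS]kVK; apply: cle_scale => //; exact: leIl.
  by rewrite -[leRHS]kVK; apply: cle_scale => //; exact: leIr.
rewrite lexI; apply/andP; split; rewrite -(cscale_r0 k0').
  by apply: cle_scale => //; rewrite -xy leIl.
by apply: cle_scale => //; rewrite -xy leIr.
Qed.

Lemma supinf_pred0 : supinf_pred (czero, czero).
Proof. by rewrite /supinf_pred /= !lexx meetxx eqxx. Qed.

Definition si0 : supInf := SupInf supinf_pred0.

Lemma supinf_predZ (k : R) (s : supInf) :
  supinf_pred (if 0 <= k then (k *c (sipair s).1, k *c (sipair s).2)
               else ((- k) *c (sipair s).2, (- k) *c (sipair s).1)).
Proof.
have cge0 (l : R) (x : C) : 0 <= l -> czero <= x -> czero <= l *c x.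
  by move=> l0 x0; rewrite -(cscale_r0 l0); apply: cle_scale.
case: s => -[x y] /= /and3P[/= x0 y0 /eqP xy].
case: ifPn => [k0|]; first by rewrite /supinf_pred /= !cge0// cscale_disj ?eqxx.
rewrite -ltNge -oppr_gt0 => /ltW k0.
by rewrite /supinf_pred /= !cge0// meetC cscale_disj ?eqxx.
Qed.

Definition siscale (k : R) (s : supInf) : supInf := SupInf (supinf_predZ k s).

Definition siopp (s : supInf) : supInf := siscale (-1) s.

Definition simeet (s t : supInf) : supInf := infimum si0 [set s; t].
Definition sijoin (s t : supInf) : supInf := supremum si0 [set s; t].
Definition sipos (s : supInf) : supInf := sijoin s si0.
Definition sineg (s : supInf) : supInf := siopp (simeet s si0).
Definition siabs (s : supInf) : supInf := sijoin s (siopp s).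

Definition si_pminfty (s : supInf) : supInf :=
  supremum si0 (range (fun m : nat => siscale m.+1%:R^-1
    (infimum si0 (range (fun n : nat => siscale n.+1%:R^-1 s))))).
Definition si_pinfty (s : supInf) : supInf := sipos (si_pminfty s).
Definition si_ninfty (s : supInf) : supInf := siopp (sineg (si_pminfty s)).

End SupInf.

Section SupInfCompletion.
Variables (R : realType) (E : vectorLatticeType R) (S : supCompletion E).
Implicit Types (x : E) (y : S) (s t : supInf S).

(* The preimage in E of an element of E^s that lies in E. *)
Definition fin_part y : E := xget 0 [set x | scincl S x = y].

Lemma fin_partK y x : y <= scincl S x -> scincl S (fin_part y) = y.
Proof.
case/scincl_lower=> z zy; rewrite /fin_part.
by case: xgetP => [w _ //|/(_ z)]; case.
Qed.

Lemma scincl0 : scincl S 0 = czero.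
Proof. by rewrite -(scale0r (0 : E)) scincl_scale// cscale0. Qed.

Lemma supinf_pred_of y :
  supinf_pred ((y `|` czero)%O, scincl S (- fin_part (y `&` czero)%O)).
Proof.
set w := fin_part _.
have wE : scincl S w = (y `&` czero)%O.
  by apply: (@fin_partK _ 0); rewrite scincl0 leIr.
have w0 : w <= 0 by rewrite -(scincl_le S) scincl0 wE leIr.
have Nw0 : 0 <= - w by have := vle_add _ _ (- w) w0; rewrite addNr addr0.
have Nw0' : czero <= scincl S (- w) by rewrite -scincl0 scincl_le.
have wK z : scincl S w +c (scincl S (- w) +c z) = z.
  by rewrite caddA -scincl_add addrN scincl0 cadd0l.
apply/and3P; split => //=; first exact: leUr.
have modular : scincl S w +c (y `|` czero)%O = y.
  apply: le_anti; apply/andP; split.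
    rewrite -[leRHS]wK; apply: cle_add; rewrite leUx; apply/andP; split.
      have := cle_add _ _ y Nw0'.
      by rewrite caddC cadd0l [y +c _]caddC.
    by rewrite -scincl0 -(addNr w) scincl_add wE; apply: cle_add; rewrite leIl.
  rewrite caddC wE meetC -scincl0 sc_add_meet scincl0 lexI; apply/andP; split.
    by rewrite caddC cadd0l leUl.
  have := cle_add _ _ y (leUr czero y).
  by rewrite caddC cadd0l [y +c _]caddC.
apply/eqP; apply: le_anti; apply/andP; split; last by rewrite lexI Nw0' leUr.
rewrite -[leLHS](cadd0l) -{1}scincl0 -{1}(addNr w) scincl_add -caddA.
rewrite -[leRHS]scincl0 -(addNr w) scincl_add; apply: cle_add.
by rewrite meetC sc_add_meet -scincl_add addrN modular scincl0 meetC wE.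
Qed.

Definition si_of y : supInf S := SupInf (supinf_pred_of y).
Definition si_incl x : supInf S := si_of (scincl S x).

(* The preimage in E of an element of E^si that lies in E. *)
Definition si_fin s : E := xget 0 [set x | si_incl x = s].

Definition lower_pos s : set E := [set x | 0 <= x /\ si_incl x <= s].

Definition finite_part s : E :=
  si_fin (supremum (si0 S)
    [set infimum (si0 S)
       [set si_incl (x - si_fin (simeet (si_incl x) (si_pinfty s))
                     - (y - si_fin (simeet (si_incl y) (siopp (si_ninfty s)))))
       | y in lower_pos (sineg s)]
    | x in lower_pos (sipos s)]).

Definition cproj (u : S) x : E :=
  let P z := fin_part
    (supremum czero (range (fun n : nat => (scincl S z `&` n%:R *c u)%O))) in
  P (vpos x) - P (vneg x).

(* |s| = (u, 0) is identified with u. *)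
Definition siproj s : E -> E := cproj (sipair (siabs s)).1.

Definition siband s : set E := [set x | siproj s x = x].

Definition siband_d s : set E := disj_compl (siband s).

Definition siproj_d s : E -> E := band_proj (siband_d s).

Definition sill s t :=
  [/\ si_pinfty s = si0 S, si_ninfty t = si0 S &
      weak_order_unit_of
        (siband_d (si_ninfty s) `&` siband_d (si_pinfty t))
        (siproj_d (si_ninfty s) (siproj_d (si_pinfty t)
          (finite_part t - finite_part s)))].

Definition radius_cvg (u : nat -> E -> E) (c : E) : S :=
  supremum czero (scincl S @` spectrum_cvg u c).

Definition in_open_interval (c : E) (rho : S) x :=
  sill (siopp (si_of (rho +c scincl S (- c)))) (si_incl x) /\
  sill (si_incl x) (si_of (scincl S c +c rho)).

End SupInfCompletion.

(* Main.v *)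
(* A component of the unit [fone] is an idempotent [p] such that [x |-> p ** x] is
   a band projection; every band projection onto a disjoint complement has this
   form. By universal completeness (Zorn's lemma and suprema of disjoint families),
   elements of [E] can be glued along a maximal disjoint family of components, so
   that the spectrum of convergence contains every [d >= 0] which on a small enough
   piece of each component lies below one of its elements. If [d = |a - c|] failed
   this, then [rho <= d] would hold on some nonzero component [p]. There the parts
   of [c + rho] and [c - rho] are finite, and the weak order units expressing
   [c - rho << a << c + rho] restrict to weak order units below the disjoint
   elements [d + (a - c)] and [d - (a - c)], which forces [p = 0]. Thus [d], and
   likewise [|b - c|], belong to the spectra of both series.
   On [[c - d, c + d]] the partial sums of [f] are Lipschitz, and those of [g] have
   a second-order Taylor bound with respect to those of [f]. Subdividing gives a
   mean value inequality, so every lower (upper) sum of [f] is at most (at least)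
   the increment of [g], and the gap between the two sums of a uniform partition
   tends to [0] in order. *)
From HB Require Import structures.
Require Import Defs.
From mathcomp Require Import all_boot all_order all_algebra.
From mathcomp Require Import all_classical all_reals.
From mathcomp Require Import ring lra.

Set Implicit Arguments.
Unset Strict Implicit.
Unset Printing Implicit Defensive.

Import Order.TTheory GRing.Theory Num.Theory.
Local Open Scope classical_set_scope.
Local Open Scope ring_scope.

(** * Vector lattices *)

(** The radius [rho] is a supremum in [E^s], possibly infinite on some components and finite on
    others, and elements of [E] are rarely comparable; so no single element of the spectrum need lie
    above [|a - c|]. Hence convergence is first obtained piecewise. Gluing the pieces is possible
    because power series are local: on a component their value depends only on the argument there.
    The relation [<<] only compares finite parts, so the sup-inf-completion is studied to show that
    finite parts exist in [E] and inherit bounds known on a component. The Lipschitz and Taylor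
    constants of the partial sums depend on the number [m] of terms, and no such constant is
    obtained for [f]. So [m] is fixed while a mesh is refined, the remaining error is a multiple of
    the uniform bound [T m], and only then does [m] increase. With no topology at hand, this last
    limit rests on the order continuity of multiplication, obtained from truncations. Commutativity
    of the product is derived from the Archimedean property, so components are first shown to be
    central. *)

Section LinearExpressions.
Variables (R : realType) (V : lmodType R).

(** Syntax for a reflective decision procedure: two linear combinations agree as soon as every atom
    has the same coefficient in both. *)
Inductive lexpr :=
| LVar of nat
| LZero
| LAdd of lexpr & lexpr
| LOpp of lexpr
| LScale of R & lexpr.

Fixpoint leval (env : seq V) (t : lexpr) : V :=
  match t with
  | LVar i => nth 0 env i
  | LZero => 0
  | LAdd t u => leval env t + leval env u
  | LOpp t => - leval env t
  | LScale k t => k *: leval env t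
  end.

Fixpoint lcoef (i : nat) (t : lexpr) : R :=
  match t with
  | LVar j => if j == i then 1 else 0
  | LZero => 0
  | LAdd t u => lcoef i t + lcoef i u
  | LOpp t => - lcoef i t
  | LScale k t => k * lcoef i t
  end.

Lemma levalE env t : leval env t = \sum_(i < size env) lcoef i t *: env`_i.
Proof.
elim: t => [j||t IHt u IHu|t IHt|k t IHt] /=.
- have [jn|nj] := ltnP j (size env).
    rewrite (bigD1 (Ordinal jn))//= eqxx scale1r big1 ?addr0// => i ij.
    by rewrite ifN ?scale0r// eq_sym.
  rewrite nth_default// big1// => i _; rewrite ifN ?scale0r//.
  by rewrite neq_ltn (leq_trans (ltn_ord i) nj) orbT.
- by rewrite big1// => i _; rewrite scale0r.
- by rewrite IHt IHu -big_split; apply: eq_bigr => i _; rewrite scalerDl.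
- by rewrite IHt -sumrN; apply: eq_bigr => i _; rewrite scaleNr.
- by rewrite IHt scaler_sumr; apply: eq_bigr => i _; rewrite scalerA.
Qed.

(** A recursive conjunction, so that it reduces to one scalar equation per atom. *)
Fixpoint leqcoef (n : nat) (t u : lexpr) : Prop :=
  if n is m.+1 then lcoef m t = lcoef m u /\ leqcoef m t u else True.

Lemma leval_eq env t u : leqcoef (size env) t u -> leval env t = leval env u.
Proof.
rewrite !levalE => tu; apply: eq_bigr => i _; congr (_ *: _).
elim: (size env) (val i) (ltn_ord i) tu => // n IH j.
rewrite ltnS leq_eqVlt => /orP[/eqP -> []//|jn [_]]; exact: IH.
Qed.

End LinearExpressions.

(* Position in [l] of the first element convertible to [x]. *)
Ltac lindex x l :=
  match l with
  | cons ?y _ => let _ := match constr:(Set) with _ => unify x y end in constr:(O)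
  | cons _ ?l' => let n := lindex x l' in constr:(S n)
  end.

Ltac latoms V x l :=
  lazymatch x with
  | @GRing.zero _ => l
  | @GRing.add _ ?a ?b => let l1 := latoms V a l in latoms V b l1
  | @GRing.opp _ ?a => latoms V a l
  | @GRing.scale _ _ _ ?a => latoms V a l
  | _ => match constr:(Set) with
         | _ => let _ := lindex x l in l
         | _ => constr:(@cons V x l)
         end
  end.

Ltac lreify R x l :=
  lazymatch x with
  | @GRing.zero _ => constr:(@LZero R)
  | @GRing.add _ ?a ?b =>
      let ta := lreify R a l in let tb := lreify R b l in constr:(@LAdd R ta tb)
  | @GRing.opp _ ?a => let ta := lreify R a l in constr:(@LOpp R ta)
  | @GRing.scale _ _ ?k ?a => let ta := lreify R a l in constr:(@LScale R k ta)
  | _ => let n := lindex x l in constr:(@LVar R n)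
  end.

(* Decides equalities of linear combinations over a field [R : realType] of the
   context, by comparing the coefficients of each atom with [ring] or [field]. *)
Ltac linear_eq :=
  rewrite -?scaler_nat;
  lazymatch goal with
  | |- @eq ?V ?x ?y =>
    let l0 := latoms V x (@nil V) in
    let l := latoms V y l0 in
    lazymatch goal with
    | R : realType |- _ =>
      let t := lreify R x l in let u := lreify R y l in
      apply: (@leval_eq R _ l t u); rewrite /leqcoef /lcoef /=;
      repeat (split; [by [ring|field]|]); exact I
    end
  end.


Section VectorLatticeBasics.
Variables (R : realType) (E : vectorLatticeType R).
Implicit Types (x y z u v w a b : E) (A : set E).

Lemma vsubr_ge0 x y : (0 <= y - x) = (x <= y).
Proof.
apply/idP/idP => h.
  have := vle_add _ _ x h; congr (_ <= _); by linear_eq.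
have := vle_add _ _ (- x) h; congr (_ <= _); by linear_eq.
Qed.

(** [vle1], [vle2] and [vle3] obtain an inequality as the sum of one, two or three known ones and
    leave an identity for [linear_eq]. *)
Lemma vle1 a b x y : a <= b -> y - x = b - a -> x <= y.
Proof. by move=> ab e; rewrite -vsubr_ge0 e vsubr_ge0. Qed.

Lemma vaddr_ge0 x y : 0 <= x -> 0 <= y -> 0 <= x + y.
Proof. by move=> x0 y0; apply: (le_trans x0); apply: (vle1 y0); linear_eq. Qed.

Lemma vle2 a b a' b' x y :
  a <= b -> a' <= b' -> y - x = (b - a) + (b' - a') -> x <= y.
Proof.
move=> ab ab' e; rewrite -vsubr_ge0 e.
by apply: vaddr_ge0; rewrite vsubr_ge0.
Qed.

Lemma vle3 a b a' b' a2 b2 x y :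
  a <= b -> a' <= b' -> a2 <= b2 ->
  y - x = (b - a) + (b' - a') + (b2 - a2) -> x <= y.
Proof.
move=> ab ab' ab2 e; rewrite -vsubr_ge0 e.
by apply: vaddr_ge0; first apply: vaddr_ge0; rewrite vsubr_ge0.
Qed.

Lemma vscale_ge0 (k : R) x : 0 <= k -> 0 <= x -> 0 <= k *: x.
Proof. by move=> k0 /(vle_scale _ _ _ k0); rewrite scaler0. Qed.

Lemma vscale_leW (k l : R) x : 0 <= x -> k <= l -> k *: x <= l *: x.
Proof.
move=> x0 kl; have : 0 <= (l - k) *: x by rewrite vscale_ge0// subr_ge0.
by move=> h; apply: (vle1 h); linear_eq.
Qed.

Lemma vmeetl x y : vmeet x y <= x.
Proof. by have := lexx (vmeet x y); rewrite le_vmeet => /andP[]. Qed.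
Lemma vmeetr x y : vmeet x y <= y.
Proof. by have := lexx (vmeet x y); rewrite le_vmeet => /andP[]. Qed.
Lemma vmeet_glb x y z : z <= x -> z <= y -> z <= vmeet x y.
Proof. by rewrite le_vmeet => -> ->. Qed.
Lemma vjoinl x y : x <= vjoin x y.
Proof. by have := lexx (vjoin x y); rewrite le_vjoin => /andP[]. Qed.
Lemma vjoinr x y : y <= vjoin x y.
Proof. by have := lexx (vjoin x y); rewrite le_vjoin => /andP[]. Qed.
Lemma vjoin_lub x y z : x <= z -> y <= z -> vjoin x y <= z.
Proof. by rewrite le_vjoin => -> ->. Qed.

Lemma vmeetC x y : vmeet x y = vmeet y x.
Proof. by apply: le_anti; rewrite !le_vmeet !vmeetl !vmeetr. Qed.
Lemma vjoinC x y : vjoin x y = vjoin y x.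
Proof. by apply: le_anti; rewrite !le_vjoin !vjoinl !vjoinr. Qed.

Lemma vmeet_mono x y x' y' : x <= x' -> y <= y' -> vmeet x y <= vmeet x' y'.
Proof.
move=> xx yy; apply: vmeet_glb; [exact: le_trans (vmeetl _ _) xx|].
exact: le_trans (vmeetr _ _) yy.
Qed.

Lemma vmeet_idl x y : x <= y -> vmeet x y = x.
Proof. by move=> xy; apply: le_anti; rewrite vmeetl vmeet_glb. Qed.
Lemma vjoin_idl x y : y <= x -> vjoin x y = x.
Proof. by move=> xy; apply: le_anti; rewrite vjoinl vjoin_lub. Qed.
Lemma vjoin_idr x y : x <= y -> vjoin x y = y.
Proof. by move=> xy; rewrite vjoinC vjoin_idl. Qed.

Lemma vmeetD x y z : vmeet (x + z) (y + z) = vmeet x y + z.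
Proof.
apply: le_anti; apply/andP; split.
  have h : vmeet (x + z) (y + z) - z <= vmeet x y.
    by apply: vmeet_glb; [apply: (vle1 (vmeetl (x + z) (y + z)))
      |apply: (vle1 (vmeetr (x + z) (y + z)))]; linear_eq.
  by apply: (vle1 h); linear_eq.
by apply: vmeet_glb; [apply: (vle1 (vmeetl x y))|apply: (vle1 (vmeetr x y))];
  linear_eq.
Qed.

Lemma vjoinN x y : vjoin (- x) (- y) = - vmeet x y.
Proof.
apply: le_anti; apply/andP; split.
  by apply: vjoin_lub; [apply: (vle1 (vmeetl x y))|apply: (vle1 (vmeetr x y))];
    linear_eq.
have h : - vjoin (- x) (- y) <= vmeet x y.
  by apply: vmeet_glb; [apply: (vle1 (vjoinl (- x) (- y)))
    |apply: (vle1 (vjoinr (- x) (- y)))]; linear_eq.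
by apply: (vle1 h); linear_eq.
Qed.

(** Translation by [x + y] takes [- x] and [- y] to [y] and [x], while negation exchanges meets and
    joins. *)
Lemma vmeet_join x y : vmeet x y + vjoin x y = x + y.
Proof.
have := vmeetD (- x) (- y) (x + y).
have -> : - x + (x + y) = y by linear_eq.
have -> : - y + (x + y) = x by linear_eq.
move=> h; rewrite vmeetC h -[X in _ + vjoin X _]opprK -[X in _ + vjoin _ X]opprK.
by rewrite vjoinN; linear_eq.
Qed.

Lemma vjoinD x y z : vjoin (x + z) (y + z) = vjoin x y + z.
Proof.
have := vmeet_join (x + z) (y + z); rewrite vmeetD => h.
have h2 := vmeet_join x y.
apply: (addrI (vmeet x y + z)); rewrite h.
have -> : vmeet x y + z + (vjoin x y + z) = (vmeet x y + vjoin x y) + (z + z).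
  by linear_eq.
by rewrite h2; linear_eq.
Qed.

Lemma vsub_meetE x y : x - vmeet x y = vpos (x - y).
Proof.
have h := vjoinD x y (- y); rewrite addrN in h.
by rewrite /vpos h -(addrK (vmeet x y) (vjoin x y)) [vjoin x y + _]addrC vmeet_join; linear_eq.
Qed.

Lemma vpos_ge0 x : 0 <= vpos x. Proof. exact: vjoinr. Qed.
Lemma vneg_ge0 x : 0 <= vneg x. Proof. exact: vjoinr. Qed.
Lemma vpos_ge x : x <= vpos x. Proof. exact: vjoinl. Qed.
Lemma vnegE x : vneg x = - vmeet x 0.
Proof. by rewrite -vjoinN oppr0. Qed.
Lemma vposBneg x : vpos x - vneg x = x.
Proof. by rewrite vnegE opprK addrC vmeet_join addr0. Qed.
Lemma vpos_id x : 0 <= x -> vpos x = x.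
Proof. exact: vjoin_idl. Qed.
Lemma vneg_id x : 0 <= x -> vneg x = 0.
Proof. by move=> x0; rewrite vnegE vmeetC vmeet_idl// oppr0. Qed.
Lemma vposN x : vpos (- x) = vneg x. Proof. by []. Qed.
Lemma vpos_neg_disj x : vmeet (vpos x) (vneg x) = 0.
Proof.
have := vmeetD x 0 (vneg x); rewrite add0r.
have -> : x + vneg x = vpos x by rewrite -{1}(vposBneg x); linear_eq.
by move=> ->; rewrite vnegE; linear_eq.
Qed.

(** Since [vabs x = vjoin (x + x) 0 - x], it suffices that [vjoin (x + x) 0] is twice [vpos x],
    which is proved by halving. *)
Lemma vabsE x : vabs x = vpos x + vneg x.
Proof.
rewrite /vabs.
have := vjoinD (x + x) 0 (- x).
have -> : x + x - x = x by linear_eq.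
rewrite add0r => ->.
have -> : vjoin (x + x) 0 = vpos x + vpos x.
  apply: le_anti; apply/andP; split.
    apply: vjoin_lub; last by rewrite vaddr_ge0 ?vpos_ge0.
    by apply: (vle2 (vpos_ge x) (vpos_ge x)); linear_eq.
  have h : vjoin (x + x) 0 = vjoin x (- x) + x.
    by rewrite -vjoinD addNr.
  have hp : x <= vjoin x (- x) by exact: vjoinl.
  have hn : - x <= vjoin x (- x) by exact: vjoinr.
  have h0 : 0 <= vjoin x (- x).
    have h2 : 0 <= 2^-1 *: (vjoin x (- x) + vjoin x (- x)).
      apply: vscale_ge0; rewrite ?invr_ge0//.
      by apply: (vle2 hp hn); linear_eq.
    by apply: (vle1 h2); linear_eq.
  have hx : vpos x <= 2^-1 *: (vjoin x (- x) + x).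
    have k0 : (0 : R) <= 2^-1 by rewrite invr_ge0.
    apply: vjoin_lub.
      have := vle_scale _ _ _ k0 hp => h2; by apply: (vle1 h2); linear_eq.
    have h2 := vle_scale _ _ _ k0 hn; by apply: (vle1 h2); linear_eq.
  by rewrite h; apply: (vle2 hx hx); linear_eq.
have e := vposBneg x.
have -> : vpos x + vneg x = vpos x + vpos x - (vpos x - vneg x) by linear_eq.
by rewrite e.
Qed.

Lemma vabs_ge0 x : 0 <= vabs x.
Proof. by rewrite vabsE vaddr_ge0 ?vpos_ge0 ?vneg_ge0. Qed.
Lemma vabs_ge x : x <= vabs x. Proof. exact: vjoinl. Qed.
Lemma vabs_geN x : - x <= vabs x. Proof. exact: vjoinr. Qed.
Lemma vabs_le x y : x <= y -> - x <= y -> vabs x <= y.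
Proof. exact: vjoin_lub. Qed.
Lemma vabs_id x : 0 <= x -> vabs x = x.
Proof. by move=> x0; rewrite vabsE vpos_id ?vneg_id ?addr0. Qed.
Lemma vabsN x : vabs (- x) = vabs x.
Proof. by rewrite /vabs opprK vjoinC. Qed.
Lemma vabs0 : vabs 0 = 0 :> E. Proof. exact: vabs_id. Qed.
Lemma vabs_sub x y : vabs (x - y) = vabs (y - x).
Proof. by rewrite -vabsN; congr vabs; linear_eq. Qed.
Lemma vabsD x y : vabs (x + y) <= vabs x + vabs y.
Proof.
apply: vabs_le.
  by apply: (vle2 (vabs_ge x) (vabs_ge y)); linear_eq.
by apply: (vle2 (vabs_geN x) (vabs_geN y)); linear_eq.
Qed.
Lemma vabsZ (k : R) x : 0 <= k -> vabs (k *: x) <= k *: vabs x.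
Proof.
move=> k0; apply: vabs_le; first exact: vle_scale k0 (vabs_ge x).
by rewrite -scalerN; exact: vle_scale k0 (vabs_geN x).
Qed.
Lemma vabs_eq0 x : vabs x = 0 -> x = 0.
Proof.
move=> h; have hp := vabs_ge x; have hn := vabs_geN x; rewrite h in hp hn.
by apply: le_anti; rewrite hp/=; apply: (vle1 hn); linear_eq.
Qed.
Lemma vmeet_ge0 x y : 0 <= x -> 0 <= y -> 0 <= vmeet x y.
Proof. exact: vmeet_glb. Qed.

(** Subtracting [vmeet x z] from the left side gives the join of its translates by [- x] and [- z],
    each of which is below both [y] and [z]. *)
Lemma vmeet_addl x y z : 0 <= x -> 0 <= y -> 0 <= z ->
  vmeet (x + y) z <= vmeet x z + vmeet y z.
Proof.
move=> x0 y0 z0.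
have h : vmeet (x + y) z - vmeet x z <= vmeet y z.
  have := vmeetD (- x) (- z) (vmeet (x + y) z) => e.
  have : vmeet (x + y) z - vmeet x z = vjoin (- x) (- z) + vmeet (x + y) z.
    by rewrite vjoinN; linear_eq.
  rewrite -vjoinD => ->.
  apply: vjoin_lub; apply: vmeet_glb.
  - by apply: (vle1 (vmeetl (x + y) z)); linear_eq.
  - by apply: (vle2 (vmeetr (x + y) z) x0); linear_eq.
  - by apply: (vle2 (vmeetr (x + y) z) y0); linear_eq.
  - by apply: (vle2 (vmeetr (x + y) z) z0); linear_eq.
by apply: (vle1 h); linear_eq.
Qed.

Lemma vdisj_le x y x' : 0 <= x' -> 0 <= y -> x' <= x -> vmeet x y = 0 ->
  vmeet x' y = 0.
Proof.
move=> x0 y0 xx e; apply: le_anti; rewrite vmeet_ge0// andbT -e.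
exact: vmeet_mono.
Qed.

Lemma vdisj_add x y z : 0 <= x -> 0 <= y -> 0 <= z ->
  vmeet x z = 0 -> vmeet y z = 0 -> vmeet (x + y) z = 0.
Proof.
move=> x0 y0 z0 xz yz; apply: le_anti; rewrite vmeet_ge0 ?vaddr_ge0// andbT.
by have := vmeet_addl x0 y0 z0; rewrite xz yz addr0.
Qed.

Lemma vdisj_natmul n x y : 0 <= x -> 0 <= y ->
  vmeet x y = 0 -> vmeet (n%:R *: x) y = 0.
Proof.
move=> x0 y0 xy; elim: n => [|n IH]; first by rewrite scale0r vmeet_idl.
rewrite -natr1 scalerDl scale1r vdisj_add//.
by rewrite vscale_ge0.
Qed.

Lemma vdisj_scale (k : R) x y : 0 <= k -> 0 <= x -> 0 <= y ->
  vmeet x y = 0 -> vmeet (k *: x) y = 0.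
Proof.
move=> k0 x0 y0 /(vdisj_natmul (Num.truncn k).+1 x0 y0); apply: vdisj_le => //.
  by rewrite vscale_ge0.
by apply: vscale_leW => //; apply: ltW; apply: truncnS_gt.
Qed.

Lemma sup_ub A s x : supremums A s -> A x -> x <= s.
Proof. by case=> + _ => h; exact: h. Qed.
Lemma sup_lub A s y : supremums A s -> (forall x, A x -> x <= y) -> s <= y.
Proof. by case=> _ h ub; apply: h. Qed.
Lemma inf_lb A s x : infimums A s -> A x -> s <= x.
Proof. by case=> + _ => h; exact: h. Qed.
Lemma inf_glb A s y : infimums A s -> (forall x, A x -> y <= x) -> y <= s.
Proof. by case=> _ h ub; apply: h. Qed.

(** Infinite distributivity: [x = vmeet x y + vjoin x y - y] is at most [z + vjoin s y - y] for
    every [x] in [A], hence so is [s]. *)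
Lemma vmeet_sup_le A s y z : supremums A s ->
  (forall x, A x -> vmeet x y <= z) -> vmeet s y <= z.
Proof.
move=> sA h.
have hs : s <= z + vjoin s y - y.
  apply: (sup_lub sA) => x Ax.
  have hx : vjoin x y <= vjoin s y.
    apply: vjoin_lub; last exact: vjoinr.
    exact: le_trans (sup_ub sA Ax) (vjoinl _ _).
  have e : x = vmeet x y + vjoin x y - y by rewrite vmeet_join; linear_eq.
  by rewrite {1}e; apply: (vle2 hx (h _ Ax)); linear_eq.
have e : vmeet s y = s + y - vjoin s y by rewrite -(vmeet_join s y); linear_eq.
by rewrite e; apply: (vle1 hs); linear_eq.
Qed.

Lemma vjoin_inf_le A s y z : infimums A s ->
  (forall x, A x -> z <= vjoin x y) -> z <= vjoin s y.
Proof.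
move=> sA h.
have hs : z + vmeet s y - y <= s.
  apply: (inf_glb sA) => x Ax.
  have hx : vmeet s y <= vmeet x y.
    exact: vmeet_mono (inf_lb sA Ax) _.
  have e : x = vmeet x y + vjoin x y - y by rewrite vmeet_join; linear_eq.
  by rewrite {1}e; apply: (vle2 hx (h _ Ax)); linear_eq.
have e : vjoin s y = s + y - vmeet s y by rewrite -(vmeet_join s y); linear_eq.
by rewrite e; apply: (vle1 hs); linear_eq.
Qed.

Lemma infN A s : supremums A s -> infimums (-%R @` A) (- s).
Proof.
move=> sA; split => [_ [x Ax <-]|y yA].
  by apply: (vle1 (sup_ub sA Ax)); linear_eq.
have h : s <= - y.
  apply: (sup_lub sA) => x Ax; have : y <= - x by apply: yA; exists x.
  by move=> h; apply: (vle1 h); linear_eq.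
by apply: (vle1 h); linear_eq.
Qed.

End VectorLatticeBasics.

Lemma supremumE d (T : porderType d) (x0 : T) (A : set T) s :
  supremums A s -> A !=set0 -> supremum x0 A = s.
Proof.
move=> sA A0; rewrite /supremum ifF; last exact/negbTE/set0P.
by apply: (@is_subset1_supremums _ _ A) => //; exact: xgetI sA.
Qed.

Lemma infimumE d (T : porderType d) (x0 : T) (A : set T) s :
  infimums A s -> A !=set0 -> infimum x0 A = s.
Proof.
move=> sA A0; rewrite /infimum ifF; last exact/negbTE/set0P.
by apply: (@is_subset1_infimums _ _ A) => //; exact: xgetI sA.
Qed.

Section Archimedean.
Variables (R : realType) (E : vectorLatticeType R).
Hypothesis Ecomp : universally_complete E.
Implicit Types (x y z : E) (A : set E).

Lemma dedekind_sup A : A !=set0 -> (exists b, forall x, A x -> x <= b) ->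
  exists s, supremums A s.
Proof. by move=> A0 [b bA]; apply: (Ecomp.1 A A0); exists b => x /bA. Qed.

Lemma dedekind_inf A : A !=set0 -> (exists b, forall x, A x -> b <= x) ->
  exists s, infimums A s.
Proof.
move=> [a Aa] [b bA].
have [||s sA] := @dedekind_sup (-%R @` A).
- by exists (- a); exists a.
- by exists (- b) => _ [x /bA bx <-]; apply: (vle1 bx); linear_eq.
exists (- s); have := infN sA; congr infimums; apply/seteqP; split => x /=.
  by move=> [_ [y Ay <-]] <-; rewrite opprK.
by move=> Ax; exists (- x); [exists x|rewrite opprK].
Qed.

(** The supremum [s] of all multiples of [x] absorbs one more copy of [x], so [s <= s - x]. *)
Lemma arch_le0 x y : (forall n, n%:R *: x <= y) -> x <= 0.
Proof.
move=> h.
have [||s sA] := @dedekind_sup (range (fun n : nat => n%:R *: x)).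
- by exists (0%:R *: x); exists 0%N.
- by exists y => _ [n _ <-].
have h2 : s <= s - x.
  apply: (sup_lub sA) => _ [n _ <-].
  have h3 : n.+1%:R *: x <= s by apply: (sup_ub sA); exists n.+1.
  by rewrite -natr1 in h3; apply: (vle1 h3); linear_eq.
by apply: (vle1 h2); linear_eq.
Qed.

Lemma arch_inv_le0 x y : (forall n, x <= n.+1%:R^-1 *: y) -> x <= 0.
Proof.
move=> h; apply: (@arch_le0 _ (vabs y)) => -[|n].
  by rewrite scale0r vabs_ge0.
have n0 : (0 : R) <= n.+1%:R by [].
have := vle_scale _ _ _ n0 (h n).
rewrite scalerA mulfV ?pnatr_eq0// scale1r => h2.
exact: le_trans h2 (vabs_ge _).
Qed.

End Archimedean.

(** * f-algebras, components and commutativity *)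

Section FAlgebraBasics.
Variables (R : realType) (E : fAlgebraType R).
Implicit Types (x y z u v w p q : E).

Lemma fmul0l x : 0 ** x = 0.
Proof. by apply: (addrI (0 ** x)); rewrite -fmulDl !addr0. Qed.
Lemma fmul0r x : x ** 0 = 0.
Proof. by apply: (addrI (x ** 0)); rewrite -fmulDr !addr0. Qed.
Lemma fmulNl x y : (- x) ** y = - (x ** y).
Proof. by rewrite -scaleN1r fmulZl scaleN1r. Qed.
Lemma fmulNr x y : x ** (- y) = - (x ** y).
Proof. by rewrite -scaleN1r fmulZr scaleN1r. Qed.
Lemma fmulBl x y z : (x - y) ** z = x ** z - y ** z.
Proof. by rewrite fmulDl fmulNl. Qed.
Lemma fmulBr x y z : z ** (x - y) = z ** x - z ** y.
Proof. by rewrite fmulDr fmulNr. Qed.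

Lemma fmul_lel z x y : 0 <= z -> x <= y -> z ** x <= z ** y.
Proof.
move=> z0 xy; have : 0 <= z ** (y - x) by rewrite fmul_ge0// vsubr_ge0.
by rewrite fmulBr vsubr_ge0.
Qed.

Lemma fmul_ler z x y : 0 <= z -> x <= y -> x ** z <= y ** z.
Proof.
move=> z0 xy; have : 0 <= (y - x) ** z by rewrite fmul_ge0// vsubr_ge0.
by rewrite fmulBl vsubr_ge0.
Qed.

Lemma fmul_le x y x' y' : 0 <= x -> 0 <= y' -> x <= x' -> y <= y' ->
  x ** y <= x' ** y'.
Proof. by move=> ? ? ? ?; apply: le_trans (fmul_lel _ _) (fmul_ler _ _). Qed.

Lemma disj_ge0l x y : vmeet x y = 0 -> 0 <= x.
Proof. by move=> <-; exact: vmeetl. Qed.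
Lemma disj_ge0r x y : vmeet x y = 0 -> 0 <= y.
Proof. by move=> <-; exact: vmeetr. Qed.

Lemma vmeetxx x : vmeet x x = x.
Proof. exact: vmeet_idl. Qed.

(** Multiplying the two disjoint factors in turn makes [x ** y] disjoint from itself. *)
Lemma disj_mul0 x y : vmeet x y = 0 -> x ** y = 0.
Proof.
move=> xy; have x0 := disj_ge0l xy; have y0 := disj_ge0r xy.
have h1 : vmeet (x ** y) x = 0 by apply: fmul_disjl => //; rewrite vmeetC.
rewrite vmeetC in h1; have := fmul_disjr _ _ _ h1 y0; by rewrite vmeetxx.
Qed.

Lemma fsq_ge0 x : 0 <= x ** x.
Proof.
have e : vpos x ** vneg x = 0 by apply: disj_mul0; exact: vpos_neg_disj.
have e' : vneg x ** vpos x = 0.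
  by apply: disj_mul0; rewrite vmeetC; exact: vpos_neg_disj.
rewrite -(vposBneg x) fmulBl !fmulBr e e'.
by rewrite subr0 sub0r opprK vaddr_ge0// fmul_ge0 ?vpos_ge0 ?vneg_ge0.
Qed.

Lemma fone_ge0 : 0 <= fone :> E.
Proof. by rewrite -[fone]fmul1l fsq_ge0. Qed.

Lemma disj_sub x y : vmeet (x - vmeet x y) (y - vmeet x y) = 0.
Proof. by rewrite vmeetD addrN. Qed.

(** Multiplication by [z] keeps [x - vmeet x y] and [y - vmeet x y] disjoint; translating back gives
    the meet of the products. *)
Lemma fmul_meet z x y : 0 <= z -> z ** vmeet x y = vmeet (z ** x) (z ** y).
Proof.
move=> z0; have h := fmul_disjl _ _ _ (disj_sub x y) z0; rewrite vmeetC in h.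
have := fmul_disjl _ _ _ h z0; rewrite vmeetC !fmulBr vmeetD => e.
by apply/esym/eqP; rewrite -subr_eq0 e.
Qed.

Lemma fmul_join z x y : 0 <= z -> z ** vjoin x y = vjoin (z ** x) (z ** y).
Proof.
move=> z0; rewrite -[x]opprK -[y]opprK vjoinN fmulNr fmul_meet//.
by rewrite -vjoinN -!fmulNr.
Qed.

Lemma fmul_pos z x : 0 <= z -> z ** vpos x = vpos (z ** x).
Proof. by move=> z0; rewrite /vpos fmul_join// fmul0r. Qed.
Lemma fmul_abs z x : 0 <= z -> z ** vabs x = vabs (z ** x).
Proof. by move=> z0; rewrite /vabs fmul_join// fmulNr. Qed.

Lemma vabsM x y : vabs (x ** y) <= vabs x ** vabs y.
Proof.
have e : x ** y = vpos x ** y - vneg x ** y by rewrite -fmulBl vposBneg.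
have hp : vabs (vpos x ** y) = vpos x ** vabs y by rewrite -fmul_abs ?vpos_ge0.
have hn : vabs (vneg x ** y) = vneg x ** vabs y by rewrite -fmul_abs ?vneg_ge0.
by rewrite e (vabsE x) fmulDl -hp -hn -[vabs (vneg _ ** _)]vabsN vabsD.
Qed.

Definition component p := vmeet p (fone - p) = 0.

Section Component.
Variable p : E.
Hypothesis cp : component p.

Lemma comp_ge0 : 0 <= p. Proof. exact: disj_ge0l cp. Qed.
Lemma comp_compl_ge0 : 0 <= fone - p. Proof. exact: disj_ge0r cp. Qed.
Lemma comp_le1 : p <= fone. Proof. by rewrite -vsubr_ge0 comp_compl_ge0. Qed.
Lemma comp_compl : component (fone - p).
Proof. by rewrite /component vmeetC -[RHS]cp; congr vmeet; linear_eq. Qed.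
Lemma comp_mulC0 : p ** (fone - p) = 0. Proof. exact: disj_mul0 cp. Qed.
Lemma comp_Cmul0 : (fone - p) ** p = 0.
Proof. by apply: disj_mul0; rewrite vmeetC. Qed.
Lemma comp_idem : p ** p = p.
Proof.
by have := comp_mulC0; rewrite fmulBr fmul1r => /eqP; rewrite subr_eq0 => /eqP.
Qed.
Lemma comp_idemA x : p ** (p ** x) = p ** x.
Proof. by rewrite fmulA comp_idem. Qed.
Lemma comp_mulCA0 x : p ** ((fone - p) ** x) = 0.
Proof. by rewrite fmulA comp_mulC0 fmul0l. Qed.
Lemma comp_CmulA0 x : (fone - p) ** (p ** x) = 0.
Proof. by rewrite fmulA comp_Cmul0 fmul0l. Qed.

Lemma comp_split x : p ** x + (fone - p) ** x = x.
Proof. by rewrite -fmulDl addrC subrK fmul1l. Qed.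

(** For [y >= 0], both [p ** y ** (fone - p)] and [(fone - p) ** y ** p] are products of disjoint
    elements and vanish, so [p ** y] and [y ** p] both equal [p ** y ** p]. *)
Lemma comp_central x : p ** x = x ** p.
Proof.
suff H y : 0 <= y -> p ** y = y ** p.
  by rewrite -(vposBneg x) fmulBl fmulBr !H ?vpos_ge0 ?vneg_ge0.
move=> y0.
have h1 : (p ** y) ** (fone - p) = 0 by apply: disj_mul0; exact: fmul_disjr.
have h2 : (fone - p) ** (y ** p) = 0.
  by apply: disj_mul0; rewrite vmeetC; exact: fmul_disjl.
rewrite fmulBr fmul1r in h1; rewrite fmulBl fmul1l in h2.
have e1 : p ** y = p ** y ** p by apply/eqP; rewrite -subr_eq0 h1.
have e2 : y ** p = p ** (y ** p) by apply/eqP; rewrite -subr_eq0 h2.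
by rewrite e1 e2 fmulA.
Qed.

Lemma comp_mull_le x : 0 <= x -> p ** x <= x.
Proof. by move=> x0; have := fmul_ler x0 comp_le1; rewrite fmul1l. Qed.

Lemma comp_disj x y : 0 <= x -> 0 <= y -> vmeet (p ** x) ((fone - p) ** y) = 0.
Proof.
by move=> x0 y0; apply: fmul_disjr => //; rewrite vmeetC; apply: fmul_disjr;
  rewrite // vmeetC.
Qed.

(** The meet [v] vanishes on [p] because it is below [x], and off [p] because it is below [p]. *)
Lemma comp_mul0_disj x : 0 <= x -> p ** x = 0 -> vmeet p x = 0.
Proof.
move=> x0 px; set v := vmeet p x.
have v0 : 0 <= v by rewrite vmeet_ge0// comp_ge0.
have pv : p ** v <= 0 by rewrite -px; apply: fmul_lel; [exact: comp_ge0|exact: vmeetr].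
have cpv : (fone - p) ** v <= 0.
  by rewrite -comp_Cmul0; apply: fmul_lel; [exact: comp_compl_ge0|exact: vmeetl].
apply: le_anti; rewrite v0 andbT -[v]comp_split.
by apply: (vle2 pv cpv); linear_eq.
Qed.

Lemma comp_abs x : p ** vabs x = vabs (p ** x).
Proof. by rewrite fmul_abs// comp_ge0. Qed.

End Component.

Lemma comp0 : component (0 : E).
Proof. by rewrite /component subr0 vmeet_idl// fone_ge0. Qed.

Lemma comp_mul p q : component p -> component q -> component (p ** q).
Proof.
move=> cp cq; rewrite /component.
have p0 := comp_ge0 cp; have q0 := comp_ge0 cq.
have Cp0 := comp_compl_ge0 cp; have Cq0 := comp_compl_ge0 cq.
have -> : fone - p ** q = (fone - p) + p ** (fone - q).
  by rewrite fmulBr fmul1r; linear_eq.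
rewrite vmeetC; apply: vdisj_add => //; try exact: fmul_ge0.
  by rewrite vmeetC; apply: fmul_disjr.
by rewrite -fmul_meet// vmeetC cq fmul0r.
Qed.

(* A consequence of [(w / 2 - n)^2 >= 0]: the truncations of [w] at [n] converge to
   [w] at rate [1 / n], which makes multiplication by [w] order continuous. *)
Lemma fmul_trunc n w : n%:R *: vpos (w - n%:R *: fone) <= w ** w.
Proof.
have k0 : (0 : R) <= n%:R by [].
have -> : n%:R *: vpos (w - n%:R *: fone) =
    vpos (n%:R *: w - (n%:R * n%:R) *: fone).
  apply: le_anti; apply/andP; split; last first.
    apply: vjoin_lub; last by rewrite vscale_ge0// vpos_ge0.
    have := vle_scale _ _ _ k0 (vpos_ge (w - n%:R *: fone)).
    by move=> h; apply: (vle1 h); linear_eq.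
  case: n {k0} => [|n]; first by rewrite scale0r vpos_ge0.
  have k0 : (0 : R) <= n.+1%:R^-1 by rewrite invr_ge0.
  have n0 : n.+1%:R != 0 :> R by rewrite pnatr_eq0.
  set u := vpos (_ - _ *: fone) ; set v := vpos (_ - _).
  suff : u <= n.+1%:R^-1 *: v.
    move/(@vle_scale R E n.+1%:R _ _ (ler0n _ _)).
    by rewrite [X in _ <= X]scalerA mulfV// scale1r.
  apply: vjoin_lub; last by rewrite vscale_ge0// vpos_ge0.
  have := vle_scale _ _ _ k0 (vpos_ge (n.+1%:R *: w - (n.+1%:R * n.+1%:R) *: fone)).
  by rewrite -/v scalerBr !scalerA mulrA mulVf// mul1r scale1r.
apply: vjoin_lub; last exact: fsq_ge0.
have h1 := fsq_ge0 (2^-1 *: w - n%:R *: fone).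
have h2 := vscale_ge0 (_ : 0 <= (3 / 4 : R)) (fsq_ge0 w).
have h3 : 0 <= (3 / 4 : R) by lra.
apply: (vle2 h1 (h2 h3)).
rewrite fmulBl !fmulBr !(fmulZl, fmulZr) !fmul1r fmul1l.
rewrite !scalerA; linear_eq.
Qed.

End FAlgebraBasics.

(** * Order continuity of the product, supports, commutativity *)

Section FAlgebraComplete.
Variables (R : realType) (E : fAlgebraType R).
Hypothesis Ecomp : universally_complete E.
Implicit Types (x y z u v w p q : E).

Lemma dec_ge0 (p : nat -> E) m : decreases_to0 p -> 0 <= p m.
Proof. by case=> _ h; apply: (inf_lb h); exists m. Qed.

Lemma dec_inf (p : nat -> E) z : decreases_to0 p -> (forall m, z <= p m) -> z <= 0.
Proof. by case=> _ h zp; apply: (inf_glb h) => _ [m _ <-]. Qed.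

Lemma dec_mono (p : nat -> E) m n : decreases_to0 p -> p (m + n)%N <= p m.
Proof.
by move=> [h _]; elim: n => [|n IH]; rewrite ?addn0// addnS; exact: le_trans (h _) IH.
Qed.

(** Order continuity of multiplication by [w]. Split [w <= n fone + t] with [t = (w - n fone)^+]:
    the first part contributes [n p_m], which decreases to [0], and the second at most [p_0 ** t],
    with [n t <= w ** w] by [fmul_trunc]. *)
Lemma dec_mul_le0 (p : nat -> E) z w : decreases_to0 p -> 0 <= w ->
  (forall m, z <= p m ** w) -> z <= 0.
Proof.
move=> dp w0 h.
apply: (@arch_le0 _ _ Ecomp _ (p 0%N ** (w ** w))) => n.
have p00 := dec_ge0 0 dp.
have n0 : (0 : R) <= n%:R by [].
set t := vpos (w - n%:R *: fone).
have wt : w <= n%:R *: fone + t.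
  by have := vpos_ge (w - n%:R *: fone) => ht; apply: (vle1 ht); linear_eq.
suff hz : z <= p 0%N ** t.
  apply: (le_trans (vle_scale _ _ _ n0 hz)).
  by rewrite -fmulZr; apply: fmul_lel => //; exact: fmul_trunc.
suff hz : z - p 0%N ** t <= 0 by apply: (vle1 hz); linear_eq.
have hm m : z - p 0%N ** t <= n%:R *: p m.
  have pm0 := dec_ge0 m dp.
  have h1 : z <= p m ** (n%:R *: fone + t).
    by apply: (le_trans (h m)); apply: fmul_lel.
  rewrite fmulDr fmulZr fmul1r in h1.
  have h2 : p m ** t <= p 0%N ** t.
    by apply: fmul_ler; [exact: vpos_ge0|exact: (dec_mono 0 m dp)].
  by apply: (vle2 h1 h2); linear_eq.
case: n n0 @t wt hm => [|n] n0 t wt hm; first by have := hm 0%N; rewrite scale0r.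
have nn0 : n.+1%:R != 0 :> R by rewrite pnatr_eq0.
have k0 : (0 : R) <= n.+1%:R^-1 by rewrite invr_ge0.
have : n.+1%:R^-1 *: (z - p 0%N ** t) <= 0.
  apply: (dec_inf dp) => m; apply: (le_trans (vle_scale _ _ _ k0 (hm m))).
  by rewrite scalerA mulVf// scale1r.
by move/(vle_scale _ _ _ n0); rewrite scalerA mulfV// scale1r scaler0.
Qed.

(* The component is [sup_n (fone `&` n w)], the unit of the band of [w]. *)
Lemma support_ex w : 0 <= w -> exists p, [/\ component p, p ** w = w &
  forall x, vmeet w x = 0 -> p ** x = 0].
Proof.
move=> w0.
pose A := range (fun n : nat => vmeet fone (n%:R *: w)).
have [||p pA] := @dedekind_sup _ _ Ecomp A.
- by exists (vmeet fone (0%:R *: w)); exists 0%N.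
- by exists fone => _ [n _ <-]; exact: vmeetl.
have p1 : p <= fone by apply: (sup_lub pA) => _ [n _ <-]; exact: vmeetl.
have Cp0 : 0 <= fone - p by rewrite vsubr_ge0.
have p0 : 0 <= p.
  apply: (sup_ub pA); exists 0%N => //.
  by rewrite scale0r vmeetC vmeet_idl// fone_ge0.
(* A common part [u] of [fone - p] and [w] can be added to each term of [A] without exceeding the
   next bound, so [p <= p - u]. *)
have pw : vmeet (fone - p) w = 0.
  set u := vmeet _ _; have u0 : 0 <= u by exact: vmeet_ge0.
  suff hp : p <= p - u.
    by apply: le_anti; rewrite u0 andbT; apply: (vle1 hp); linear_eq.
  apply: (sup_lub pA) => _ [n _ <-].
  suff : vmeet fone (n%:R *: w) + u <= p by move=> h; apply: (vle1 h); linear_eq.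
  apply: (@le_trans _ _ (vmeet fone (n.+1%:R *: w))); last first.
    by apply: (sup_ub pA); exists n.+1.
  have hp : vmeet fone (n%:R *: w) <= p by apply: (sup_ub pA); exists n.
  apply: vmeet_glb.
    by apply: (vle2 (vmeetl (fone - p) w) hp); linear_eq.
  rewrite -natr1; apply: (vle2 (vmeetr (fone - p) w) (vmeetr fone (n%:R *: w))).
  by linear_eq.
have cp : component p.
  apply: le_anti; apply/andP; split; last exact: vmeet_ge0.
  apply: (vmeet_sup_le pA) => _ [n _ <-].
  rewrite -(vdisj_natmul n w0 Cp0 (_ : vmeet w (fone - p) = 0)); last by rewrite vmeetC.
  by apply: vmeet_mono => //; exact: vmeetr.
exists p; split => //.
  by apply/esym/eqP; rewrite -subr_eq0 -{1}[w]fmul1l -fmulBl disj_mul0.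
move=> x wx; have x0 := disj_ge0r wx; apply: disj_mul0.
apply: le_anti; apply/andP; split; last exact: vmeet_ge0.
apply: (vmeet_sup_le pA) => _ [n _ <-].
rewrite -(vdisj_natmul n w0 x0 wx).
by apply: vmeet_mono => //; exact: vmeetr.
Qed.

(** Used with [q] the support of [w]: as [w] vanishes off [p], it is disjoint from [fone - p], which
    [q] therefore kills. *)
Lemma support_below p q w : component p -> 0 <= w -> (fone - p) ** w = 0 ->
  (forall x, vmeet w x = 0 -> q ** x = 0) -> q ** p = q.
Proof.
move=> cp w0 pw qd; have : q ** (fone - p) = 0.
  by apply: qd; rewrite vmeetC; apply: comp_mul0_disj => //; exact: comp_compl.
by rewrite fmulBr fmul1r => /eqP; rewrite subr_eq0 => /eqP.
Qed.

(* Where [w <= 0] fails, it fails on a whole component, the support of [vpos w]. *)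
Lemma le0_local w :
  (forall p, component p -> p != 0 -> exists q,
    [/\ component q, q != 0, q ** p = q & q ** w <= 0]) -> w <= 0.
Proof.
move=> H; have [p [cp pw pd]] := support_ex (vpos_ge0 w).
have [p0|pn0] := eqVneq p 0.
  by apply: (le_trans (vpos_ge w)); rewrite -pw p0 fmul0l.
have [q [cq qn0 qp qw]] := H p cp pn0.
case/eqP: qn0; rewrite -qp comp_central//; apply: pd; rewrite vmeetC.
apply: comp_mul0_disj => //; first exact: vpos_ge0.
by rewrite fmul_pos ?comp_ge0// /vpos vjoin_idr.
Qed.

(** Local approximation by scalars: [k] is within [eps] of the supremum of the reals with
    [k *: p <= p ** x]. Since [k + eps] exceeds that supremum, [x] is below [k + eps] on a nonzero
    part [q] of [p]. *)
Lemma comp_almost_const (p x : E) (eps : R) : component p -> p != 0 -> 0 <= x ->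
  0 < eps -> exists q (k : R), [/\ component q, q != 0, q ** p = q,
    k *: q <= q ** x & q ** x <= (k + eps) *: q].
Proof.
move=> cp pn0 x0 eps0; have p0 := comp_ge0 cp.
pose A := [set k : R | k *: p <= p ** x].
have A0 : A 0 by rewrite /A /= scale0r fmul_ge0.
have [b Ab] : exists b : R, ubound A b.
  apply: contrapT => nb.
  case/negP: pn0; apply/eqP/le_anti; rewrite p0 andbT.
  apply: (@arch_le0 _ _ Ecomp _ (p ** x)) => n.
  apply: contrapT => nA; apply: nb; exists n%:R => k Ak.
  rewrite leNgt; apply/negP => nk; apply: nA.
  by apply: le_trans Ak; apply: vscale_leW => //; exact: ltW.
have hs : has_sup A by split; [exists 0|exists b].
have [k Ak hk] := sup_adherent eps0 hs.
pose w := (k + eps) *: p - p ** x.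
have [q [cq qw qd]] := support_ex (vpos_ge0 w).
have w'0 : (fone - p) ** vpos w = 0.
  rewrite fmul_pos ?comp_compl_ge0// /w fmulBr fmulZr comp_Cmul0// comp_CmulA0//.
  by rewrite scaler0 subr0 vpos_id.
have qp : q ** p = q by apply: support_below qd => //; exact: vpos_ge0.
have q0 := comp_ge0 cq.
exists q, k; split => //.
- apply/eqP => qe; move: qw; rewrite qe fmul0l => we.
  have : w <= 0 by apply: (le_trans (vpos_ge _)); rewrite -we.
  move=> hw; have : A (k + eps) by rewrite /A /=; apply: (vle1 hw); rewrite /w; linear_eq.
  move/(ub_le_sup (ex_intro _ b Ab)); rewrite leNgt => /negP; apply.
  by move: hk; rewrite ltrBlDr.
- have := fmul_lel q0 Ak; by rewrite fmulZr fmulA qp.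
- have : q ** vneg w = 0 by apply: qd; exact: vpos_neg_disj.
  move=> qn; have : 0 <= q ** w.
    by rewrite -(vposBneg w) fmulBr qn subr0 fmul_ge0// vpos_ge0.
  rewrite /w fmulBr fmulZr fmulA qp => h; apply: (vle1 h); linear_eq.
Qed.

(** On a small component [x] is a scalar up to a remainder [u] with [0 <= u <= eps *: q]. Scalars
    commute with [y], so the commutator there is that of [u], of size at most [eps *: (2 *: y)]. *)
Lemma fmulC x y : x ** y = y ** x.
Proof.
suff H u v : 0 <= u -> 0 <= v -> u ** v = v ** u.
  by rewrite -(vposBneg x) -(vposBneg y) !fmulBl !fmulBr;
    rewrite ![vpos x ** _]H ?vpos_ge0 ?vneg_ge0// ![vneg x ** _]H ?vpos_ge0 ?vneg_ge0//;
    linear_eq.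
move=> {x y} x0 y0; move: u v x0 y0 => x y x0 y0.
apply/eqP; rewrite -subr_eq0; apply/eqP; apply: vabs_eq0.
apply: le_anti; rewrite vabs_ge0 andbT.
apply: (@arch_inv_le0 _ _ Ecomp _ (2 *: y)) => n.
suff : vabs (x ** y - y ** x) - n.+1%:R^-1 *: (2 *: y) <= 0.
  by move=> h; apply: (vle1 h); linear_eq.
apply: le0_local => p cp pn0.
have eps0 : (0 : R) < n.+1%:R^-1 by rewrite invr_gt0.
have [q [k [cq qn0 qp h1 h2]]] := comp_almost_const cp pn0 x0 eps0.
exists q; split => //; set eps := n.+1%:R^-1 in eps0 h2 *.
have q0 := comp_ge0 cq.
pose u := q ** x - k *: q.
have u0 : 0 <= u by rewrite /u vsubr_ge0.
have ue : u <= eps *: q by apply: (vle1 h2); rewrite /u; linear_eq.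
have e : q ** (x ** y - y ** x) = u ** y - y ** u.
  have e1 : y ** (q ** x) = q ** (y ** x).
    by rewrite !fmulA (comp_central cq y).
  by rewrite /u fmulBl !fmulBr fmulZl fmulZr e1 -(comp_central cq y) fmulA; linear_eq.
rewrite fmulBr comp_abs// e.
have h3 : u ** y <= eps *: (q ** y) by rewrite -fmulZl; apply: fmul_ler.
have h4 : y ** u <= eps *: (q ** y).
  by rewrite (comp_central cq) -fmulZr; apply: fmul_lel.
have h5 : vabs (u ** y - y ** u) <= u ** y + y ** u.
  apply: (le_trans (vabsD _ _)); rewrite vabsN.
  by rewrite !vabs_id ?fmul_ge0.
by apply: (vle3 h3 h4 h5); rewrite !fmulZr; linear_eq.
Qed.

End FAlgebraComplete.

(** * Gluing, bands and the spectrum of convergence *)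

Section Patching.
Variables (R : realType) (E : fAlgebraType R).
Hypothesis Ecomp : universally_complete E.
Implicit Types (x y z u v w p q r : E) (A B D : set E).

(** The last clause says that the family exhausts [fone], in the form in which it is used: an order
    relation may be checked piece by piece. *)
Definition comp_partition A :=
  [/\ forall p, A p -> component p,
      forall p q, A p -> A q -> p != q -> p ** q = 0 &
      forall w, (forall p, A p -> p ** w <= 0) -> w <= 0].

Lemma exhaustion D : (forall p, D p -> component p) ->
  (forall p, component p -> p != 0 -> exists q, [/\ D q, q != 0 & q ** p = q]) ->
  exists2 A, A `<=` D & comp_partition A.
Proof.
move=> Dc Dd.
(* The library form of Zorn's lemma concerns disjoint sets, so a component is represented by the
   nonzero elements living on it; two such sets are disjoint exactly when the product of the
   components is [0]. *)
pose F p := [set z : E | z != 0 /\ z ** p = z].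
have [A [AD tA maxA]] := ex_maximal_disjoint_subcollection F D.
have Ac p : A p -> component p by move=> /AD/Dc.
exists A => //; split => //.
  move=> p q Ap Aq pq; have [//|pq0] := eqVneq (p ** q) 0.
  case/eqP: pq; apply: (tA p q Ap Aq); exists (p ** q); split.
    by split=> //; rewrite -fmulA -(fmulC Ecomp p) (comp_idemA (Ac _ Ap)).
  by split=> //; rewrite -fmulA (comp_idem (Ac _ Aq)).
move=> w Aw; apply: (le0_local Ecomp) => p cp pn0.
have [[r [Ar rp]]|nr] := pselect (exists r, A r /\ r ** p != 0).
  exists (r ** p); split => //; first exact: comp_mul (Ac _ Ar) cp.
    by rewrite -fmulA comp_idem.
  rewrite (fmulC Ecomp r) -fmulA -(fmul0r p).
  by apply: fmul_lel; [exact: comp_ge0|exact: Aw].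
(* A part [q] of [p] in [D] is orthogonal to all of [A] and could be added to it, against
   maximality. *)
exfalso; have [q [Dq qn0 qp]] := Dd p cp pn0.
have rq r : A r -> r ** q = 0.
  move=> Ar; rewrite -qp (fmulC Ecomp q) fmulA.
  have -> : r ** p = 0 by apply: contrapT => /eqP h; apply: nr; exists r.
  by rewrite fmul0l.
have nAq : ~ A q.
  by move=> Aq; move: (rq q Aq); rewrite (comp_idem (Dc _ Dq)) => /eqP; exact/negP.
apply: (maxA (A `|` [set q])).
- split; first by move=> x Ax; left.
  by move=> h; apply: nAq; apply: h; right.
- by move=> x [/AD//|->].
- have disj r : A r -> F r `&` F q = set0.
    move=> Ar; apply/seteqP; split => // z [[zn0 zr] [_ zq]].
    by case/eqP: zn0; rewrite -zq -zr -fmulA rq// fmul0r.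
  move=> i j [Ai|->] [Aj|->] // h.
  + exact: tA h.
  + by move: h; rewrite disj// => -[].
  + by move: h; rewrite setIC disj// => -[].
Qed.

(** The pieces [p ** f p] are positive and pairwise disjoint, so universal completeness gives their
    supremum. Adjoining [0] keeps the family nonempty. *)
Lemma patch_comp_ge0 A (f : E -> E) : comp_partition A -> (forall p, A p -> 0 <= f p) ->
  exists x, forall p, A p -> p ** x = p ** f p.
Proof.
move=> [Ac Ad At] f0.
pose B := [set y | y = 0 \/ exists2 p, A p & y = p ** f p].
have B0 y : B y -> 0 <= y.
  by case=> [->//|[p Ap ->]]; rewrite fmul_ge0 ?f0// comp_ge0//; exact: Ac.
have [||x xB] := Ecomp.2 B _ B0.
- by exists 0; left.
- move=> y z [->|[p Ap ->]] [->|[q Aq ->]] // yz.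
  + by rewrite vmeet_idl// B0//; right; exists q.
  + by rewrite vmeetC vmeet_idl// B0//; right; exists p.
  + have cp := Ac _ Ap; have cq := Ac _ Aq.
    have pq : p != q by apply/eqP => e; apply: yz; rewrite e.
    have pq0 : vmeet p q = 0.
      by apply: comp_mul0_disj => //; [exact: comp_ge0|exact: Ad].
    apply: fmul_disjr; last exact: f0.
    by rewrite vmeetC; apply: fmul_disjr; [rewrite vmeetC|exact: f0].
exists x => p Ap; have cp := Ac _ Ap; have p0 := comp_ge0 cp.
have x0 : 0 <= x by apply: (sup_ub xB); left.
apply: le_anti; apply/andP; split; last first.
  rewrite -[X in X <= _](comp_idemA cp); apply: fmul_lel => //.
  by apply: (sup_ub xB); right; exists p.
(* Every piece other than that of [p] lives off [p]. *)
have h : x <= p ** f p + (fone - p) ** x.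
  have Cx0 : 0 <= (fone - p) ** x by rewrite fmul_ge0// comp_compl_ge0.
  have px0 : 0 <= p ** f p by rewrite fmul_ge0// f0.
  apply: (sup_lub xB) => y [->|[q Aq ->]]; first exact: vaddr_ge0.
  have [<-|pq] := eqVneq p q; first by apply: (vle1 Cx0); linear_eq.
  have h1 : q ** f q <= (fone - p) ** x.
    have -> : q ** f q = (fone - p) ** (q ** f q).
      by rewrite fmulBl fmul1l fmulA (Ad p q)// fmul0l subr0.
    apply: fmul_lel; first exact: comp_compl_ge0.
    by apply: (sup_ub xB); right; exists q.
  by apply: (vle2 px0 h1); linear_eq.
have := fmul_lel p0 h.
by rewrite fmulDr comp_idemA// comp_mulCA0// addr0.
Qed.

Lemma patch_comp A (f : E -> E) : comp_partition A ->
  exists x, forall p, A p -> p ** x = p ** f p.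
Proof.
move=> cA.
have [x xP] := @patch_comp_ge0 A (fun p => vpos (f p)) cA (fun p _ => vpos_ge0 _).
have [y yP] := @patch_comp_ge0 A (fun p => vneg (f p)) cA (fun p _ => vneg_ge0 _).
by exists (x - y) => p Ap; rewrite fmulBr xP// yP// -fmulBr vposBneg.
Qed.

Lemma part_le A x y : comp_partition A ->
  (forall p, A p -> p ** x <= p ** y) -> x <= y.
Proof.
move=> [_ _ h] xy; suff : x - y <= 0 by move=> k; apply: (vle1 k); linear_eq.
by apply: h => p /xy k; rewrite fmulBr; apply: (vle1 k); linear_eq.
Qed.


Lemma comp_bandE p x : component p -> p ** x = x <-> (fone - p) ** x = 0.
Proof.
move=> cp; rewrite fmulBl fmul1l; split=> [->|/eqP]; first exact: subrr.
by rewrite subr_eq0 => /eqP.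
Qed.

Lemma is_band_comp p : component p -> is_band [set x | p ** x = x].
Proof.
move=> cp; have Cp0 := comp_compl_ge0 cp; split.
- by rewrite /= fmul0r.
- by move=> x y /= hx hy; rewrite fmulDr hx hy.
- by move=> k x /= hx; rewrite fmulZr hx.
- move=> x y /= hy xy; apply/(comp_bandE _ cp).
  move/(comp_bandE _ cp) : hy => hy.
  apply: vabs_eq0; rewrite -fmul_abs//; apply: le_anti.
  rewrite [X in _ && X]fmul_ge0 ?vabs_ge0// andbT.
  have -> : 0 = (fone - p) ** vabs y by rewrite fmul_abs// hy vabs0.
  exact: fmul_lel.
- move=> B x Bp xB /=; apply/(comp_bandE _ cp).
  (* [is_band] also speaks of the empty subset: a supremum of it is a least element of [E], which
     forces [x <= x - vabs x]. *)
  have [[b Bb]|nB] := pselect (B !=set0); last first.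
    have h : x <= x - vabs x by apply: (sup_lub xB) => b Bb; case: nB; exists b.
    suff -> : x = 0 by rewrite fmul0r.
    apply: vabs_eq0; apply: le_anti; rewrite vabs_ge0 andbT.
    by apply: (vle1 h); linear_eq.
  apply: le_anti; apply/andP; split.
    have h : x <= p ** x.
      apply: (sup_lub xB) => y By; rewrite -(Bp y By).
      by apply: fmul_lel; [exact: comp_ge0|exact: (sup_ub xB)].
    by rewrite fmulBl fmul1l; apply: (vle1 h); linear_eq.
  rewrite -((comp_bandE b cp).1 (Bp _ Bb)); apply: fmul_lel => //.
  exact: (sup_ub xB).
Qed.

Lemma disj_compl_comp p : component p ->
  disj_compl [set x | p ** x = x] = [set x | (fone - p) ** x = x].
Proof.
move=> cp; apply/seteqP; split => z /=.
  move=> hz; apply/(comp_bandE _ (comp_compl cp)).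
  have -> : fone - (fone - p) = p by linear_eq.
  apply: vabs_eq0; rewrite -fmul_abs ?comp_ge0//.
  have := hz (p ** vabs z); rewrite /= comp_idemA// => /(_ erefl).
  rewrite [vabs (p ** _)]vabs_id ?fmul_ge0 ?vabs_ge0 ?comp_ge0//.
  by rewrite vmeetC vmeet_idl//; apply: comp_mull_le => //; exact: vabs_ge0.
move=> hz y /= hy.
rewrite -hz -hy -(fmul_abs _ (comp_compl_ge0 cp)) -(fmul_abs _ (comp_ge0 cp)) vmeetC.
by apply: comp_disj => //; exact: vabs_ge0.
Qed.

Lemma band_proj_comp p x : component p ->
  band_proj [set x | p ** x = x] x = p ** x.
Proof.
move=> cp; rewrite /band_proj disj_compl_comp//; apply: xget_unique.
  split=> /=; first exact: comp_idemA.
  have -> : x - p ** x = (fone - p) ** x by rewrite fmulBl fmul1l.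
  by rewrite comp_idemA//; exact: comp_compl.
move=> y /= [hy hxy]; rewrite -hy.
have : p ** (x - y) = 0 by rewrite -hxy comp_mulCA0.
by rewrite fmulBr => /eqP; rewrite subr_eq0 => /eqP.
Qed.

(** Any [y >= 0] living on [p] is the supremum of the [vmeet y (n *: w)], which lie in every band
    containing [w]: the defect [y - s] is disjoint from [w], hence killed by [p]. *)
Lemma band_gen_comp w p : component p -> p ** w = w -> 0 <= w ->
  (forall x, vmeet w x = 0 -> p ** x = 0) ->
  band_gen [set w] = [set x | p ** x = x].
Proof.
move=> cp pw w0 pd; have p0 := comp_ge0 cp; apply/seteqP; split => x.
  by apply; [exact: is_band_comp|move=> _ ->].
move=> /= px B [B0 BD BZ Bs Bsup] wB.
suff H y : 0 <= y -> p ** y = y -> B y.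
  apply: (Bs _ (vabs x)); last by rewrite [in X in _ <= X]vabs_id ?vabs_ge0.
  by apply: H; rewrite ?vabs_ge0// fmul_abs// px.
move=> {px x} y0 py.
pose A := range (fun n : nat => vmeet y (n%:R *: w)).
have nw n : 0 <= n%:R *: w by rewrite vscale_ge0.
have [||s sA] := @dedekind_sup _ _ Ecomp A.
- by exists (vmeet y (0%:R *: w)); exists 0%N.
- by exists y => _ [n _ <-]; exact: vmeetl.
have sy : s <= y by apply: (sup_lub sA) => _ [n _ <-]; exact: vmeetl.
have ys0 : 0 <= y - s by rewrite vsubr_ge0.
have dw : vmeet w (y - s) = 0.
  set u := vmeet _ _; have u0 : 0 <= u by exact: vmeet_ge0.
  suff hs : s <= s - u.
    by apply: le_anti; rewrite u0 andbT; apply: (vle1 hs); linear_eq.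
  apply: (sup_lub sA) => _ [n _ <-].
  suff h : vmeet y (n%:R *: w) + u <= s by apply: (vle1 h); linear_eq.
  have hn : vmeet y (n%:R *: w) <= s by apply: (sup_ub sA); exists n.
  apply: (@le_trans _ _ (vmeet y (n.+1%:R *: w))); last first.
    by apply: (sup_ub sA); exists n.+1.
  apply: vmeet_glb.
    by apply: (vle2 (vmeetr w (y - s)) hn); rewrite -/u; linear_eq.
  rewrite -natr1; apply: (vle2 (vmeetl w (y - s)) (vmeetr y (n%:R *: w))).
  by rewrite -/u; linear_eq.
have s0 : 0 <= s.
  by apply: (sup_ub sA); exists 0%N; rewrite // scale0r vmeetC vmeet_idl.
have ps : p ** s = s.
  have [_ _ _ solid _] := is_band_comp cp.
  by apply: (solid s y py); rewrite !vabs_id.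
have -> : y = s.
  have := pd _ dw; rewrite fmulBr py ps => /eqP.
  by rewrite subr_eq0 => /eqP.
apply: (Bsup A) => // _ [n _ <-].
apply: (Bs _ (n%:R *: w)); first by apply/BZ/wB.
by rewrite !vabs_id ?vmeet_ge0//; exact: vmeetr.
Qed.

(** The component is [fone - s], where [s] is the supremum of the supports of the elements of [A];
    adjoining [0] to these supports covers an empty [A]. *)
Lemma disj_compl_ex A : exists2 p, component p & disj_compl A = [set x | p ** x = x].
Proof.
pose T := [set q | component q /\ (q = 0 \/ exists y, [/\ A y, q ** vabs y = vabs y &
  forall x, vmeet (vabs y) x = 0 -> q ** x = 0])].
have [||s sT] := @dedekind_sup _ _ Ecomp T.
- by exists 0; split; [exact: comp0|left].
- by exists fone => q [/comp_le1].
have s0 : 0 <= s by apply: (sup_ub sT); split; [exact: comp0|left].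
have s1 : s <= fone by apply: (sup_lub sT) => q [/comp_le1].
have cs : component s.
  apply: le_anti; apply/andP; split; last by rewrite vmeet_ge0// vsubr_ge0.
  apply: (vmeet_sup_le sT) => q Tq; have [cq _] := Tq.
  rewrite -[X in _ <= X]cq; apply: vmeet_mono => //.
  by apply: (vle1 (sup_ub sT Tq)); linear_eq.
exists (fone - s); first exact: comp_compl.
have Ce : fone - (fone - s) = s by linear_eq.
apply/seteqP; split => x /=.
  move=> hx; apply/(comp_bandE _ (comp_compl cs)); rewrite Ce.
  apply: vabs_eq0; rewrite -fmul_abs//; apply: disj_mul0.
  apply: le_anti; rewrite [X in _ && X]vmeet_ge0 ?vabs_ge0// andbT.
  apply: (vmeet_sup_le sT) => q [cq [->|[y [Ay qy qd]]]].
    by rewrite vmeet_idl// vabs_ge0.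
  rewrite comp_mul0_disj ?vabs_ge0//; apply: qd.
  by rewrite vmeetC; exact: hx.
move=> /(comp_bandE _ (comp_compl cs)); rewrite Ce => sx y Ay.
have [q [cq qy qd]] := support_ex Ecomp (vabs_ge0 y).
have qs : q <= s by apply: (sup_ub sT); split=> //; right; exists y.
rewrite vmeetC -qy; apply: fmul_disjr; last exact: vabs_ge0.
apply: (vdisj_le (comp_ge0 cq) (vabs_ge0 _) qs).
by apply: comp_mul0_disj; rewrite ?vabs_ge0// fmul_abs// sx vabs0.
Qed.

(** With [p] the component of the complement of [B], [P x] is killed by [p] and [x - P x] lives on
    [p], so [x - P x = p ** x]. *)
Lemma band_projectionE (P : E -> E) : is_band_projection P ->
  exists2 p, component p & forall x, P x = p ** x.
Proof.
move=> [B bB hP].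
have [p cp Bp] := disj_compl_ex B.
exists (fone - p) => [|x]; first exact: comp_compl.
have [BPx dx] := hP x; rewrite Bp /= in dx.
have pPx : p ** P x = 0.
  have : disj_compl B (p ** vabs (P x)) by rewrite Bp /= comp_idemA.
  move/(_ _ BPx); rewrite vabs_id ?fmul_ge0 ?vabs_ge0 ?comp_ge0//.
  rewrite vmeet_idl; last by apply: comp_mull_le; rewrite ?vabs_ge0.
  by rewrite fmul_abs ?comp_ge0//; exact: vabs_eq0.
by move: dx; rewrite fmulBl fmul1l fmulBr pPx subr0 => ->; linear_eq.
Qed.

End Patching.

(** * Locality and gluing of uniform convergence *)

Section UniformConvergence.
Variables (R : realType) (E : fAlgebraType R).
Hypothesis Ecomp : universally_complete E.
Implicit Types (x y z w c d p q r : E) (A B D : set E) (u : nat -> E -> E).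

Lemma order_cvg_unique (s : nat -> E) l l' : order_cvg s l -> order_cvg s l' -> l = l'.
Proof.
move=> [p dp hp] [p' dp' hp'].
suff h : vabs (l - l') <= 0.
  apply/eqP; rewrite -subr_eq0; apply/eqP/vabs_eq0/le_anti.
  by rewrite h vabs_ge0.
apply: (dec_inf dp') => n.
suff h : vabs (l - l') - p' n <= 0 by apply: (vle1 h); linear_eq.
apply: (dec_inf dp) => m.
have h1 := hp (m + n)%N; have h2 := hp' (m + n)%N.
have h3 := dec_mono m n dp; have h4 := dec_mono n m dp'; rewrite addnC in h4.
have h5 := vabsD (l - s (m + n)%N) (s (m + n)%N - l').
have e : l - s (m + n)%N + (s (m + n)%N - l') = l - l' by linear_eq.
rewrite e (vabs_sub l (s _)) in h5.
apply: (vle3 h5 (le_trans h1 h3) (le_trans h2 h4)); linear_eq.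
Qed.

Definition local_series u := forall q n x y, component q ->
  q ** x = q ** y -> q ** u n x = q ** u n y.

Lemma local_partial_sum u q m x y : local_series u -> component q ->
  q ** x = q ** y -> q ** partial_sum u m x = q ** partial_sum u m y.
Proof.
move=> lu cq xy; rewrite /partial_sum.
have sumr (F : 'I_m.+1 -> E) : q ** (\sum_n F n) = \sum_n q ** F n.
  by elim/big_rec2 : _ => [|i a b _ <-]; rewrite ?fmul0r// fmulDr.
by rewrite !sumr; apply: eq_bigr => i _; exact: lu.
Qed.

(** The hypothesis and [exhaustion] give a partition into components [q], each with a radius [r q]
    dominating [d] there; limits and error bounds are then glued over the partition. *)
Lemma spectrum_local u c d : local_series u -> 0 <= d ->
  (forall p, component p -> p != 0 -> exists q r, [/\ component q, q != 0, q ** p = q,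
     spectrum_cvg u c r & q ** d <= q ** r]) ->
  spectrum_cvg u c d.
Proof.
move=> lu d0 H.
pose D := [set q | component q /\ exists2 r, spectrum_cvg u c r & q ** d <= q ** r].
have [q []//|p cp pn0|A AD cA] := @exhaustion _ _ Ecomp D.
  have [q [r [cq qn0 qp hr qdr]]] := H p cp pn0.
  by exists q; split => //; split => //; exists r.
have Ac p : A p -> component p by move=> /AD[].
have /choice[r hr] q : exists r, A q -> spectrum_cvg u c r /\ q ** d <= q ** r.
  have [/AD[_ [r hr hq]]|nA] := pselect (A q); first by exists r.
  by exists 0.
have /choice[h hh] q : exists h : E -> E, A q -> exists2 P : nat -> E,
    decreases_to0 P & forall m x, x \in `[c - r q, c + r q] ->
       vabs (partial_sum u m x - h x) <= P m.
  have [Aq|nA] := pselect (A q); last by exists id.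
  by have [[_ [h hP]] _] := hr q Aq; exists h.
have /choice[P hP] q : exists P : nat -> E, A q ->
    decreases_to0 P /\ forall m x, x \in `[c - r q, c + r q] ->
       vabs (partial_sum u m x - h q x) <= P m.
  have [Aq|nA] := pselect (A q); last by exists (fun=> 0).
  by have [P dP hq] := hh q Aq; exists P.
(* Off [q] the argument is replaced by the centre [c]. This puts it into the interval of radius
   [r q] and, by locality, changes nothing on [q]. *)
have /choice[g hg] x := patch_comp Ecomp (fun q => h q (q ** x + (fone - q) ** c)) cA.
have /choice[T hT] m := patch_comp Ecomp (fun q => P q m) cA.
split => //; exists g, T.
  split.
    move=> m; apply: (part_le cA) => q Aq; rewrite !hT//.
    apply: fmul_lel; first exact/comp_ge0/Ac.
    by have [[]] := hP q Aq.
  split=> [_ [m _ <-]|z zT].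
    apply: (part_le cA) => q Aq; rewrite hT// fmul0r fmul_ge0//.
      exact/comp_ge0/Ac.
    by have [dP _] := hP q Aq; exact: dec_ge0.
  apply: (part_le cA) => q Aq; rewrite fmul0r.
  have [dP _] := hP q Aq; apply: (dec_inf dP) => m.
  have h1 : z <= T m by apply: zT; exists m.
  have h2 := fmul_lel (comp_ge0 (Ac _ Aq)) h1; rewrite hT// in h2.
  exact: le_trans h2 (comp_mull_le (Ac _ Aq) (dec_ge0 m dP)).
move=> m x; rewrite in_itv /= => /andP[x1 x2].
apply: (part_le cA) => q Aq; have cq := Ac _ Aq; have q0 := comp_ge0 cq.
rewrite hT// fmul_abs// fmulBr hg//.
set xq := q ** x + (fone - q) ** c.
have e : q ** x = q ** xq by rewrite /xq fmulDr comp_idemA// comp_mulCA0// addr0.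
rewrite (local_partial_sum m lu cq e) -fmulBr -fmul_abs//.
apply: fmul_lel => //; have [_ hq] := hP q Aq; apply: hq.
have [[r0 _] qdr] := hr q Aq.
have h3 := comp_mull_le cq r0.
have h1 := fmul_lel q0 x1; have h2 := fmul_lel q0 x2.
rewrite fmulBr in h1; rewrite fmulDr in h2.
rewrite in_itv /=; apply/andP; split; rewrite /xq fmulBl fmul1l.
  by apply: (vle3 h1 qdr h3); linear_eq.
by apply: (vle3 h2 qdr h3); linear_eq.
Qed.

Lemma spectrum_fun u c d : spectrum_cvg u c d ->
  exists2 P : nat -> E, decreases_to0 P &
    forall x, c - d <= x <= c + d -> series_dom u x /\
      forall m, vabs (partial_sum u m x - series_fun u x) <= P m.
Proof.
move=> [d0 [h [P dP hP]]]; exists P => // x xd.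
have cv : order_cvg (partial_sum u ^~ x) (h x).
  by exists P => // m; apply: hP; rewrite in_itv.
have e : series_fun u x = h x.
  by apply: xget_unique => // y hy; exact: order_cvg_unique hy cv.
by split=> [|m]; [exists (h x)|rewrite e; apply: hP; rewrite in_itv].
Qed.

End UniformConvergence.

(** * The sup-inf-completion *)

Section SupCompletionBasics.
Variables (R : realType) (E : vectorLatticeType R) (S : supCompletion E).
Implicit Types (x y z : E) (u v w : S) (A : set E).
Local Notation i := (scincl S).

Lemma sc_sup_ex (B : set S) : B !=set0 -> exists s, supremums B s.
Proof.
move=> B0; have [t ht] := sc_top S.
by apply: (sc_sup B0); exists t => x _; exact: ht.
Qed.

Lemma sc_inf_ex (B : set S) : B !=set0 -> (forall b, B b -> czero <= b) ->
  exists s, infimums B s.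
Proof. by move=> B0 hB; apply: (sc_inf B0); exists czero => x /hB. Qed.

Lemma scincl_inj x y : i x = i y -> x = y.
Proof. by move=> e; apply: le_anti; rewrite -!(scincl_le S) e lexx. Qed.

Lemma fin_part_scincl x : fin_part (i x) = x.
Proof. by apply: xget_unique => // y; exact: scincl_inj. Qed.

(** Suprema taken in [E] remain suprema in [E^s]: the meet of [i s] and [u] is below an element of
    [E], hence comes from some [z] in [E], and [z] bounds [A]. *)
Lemma scincl_sup_le A s u : A !=set0 -> supremums A s ->
  (forall x, A x -> i x <= u) -> i s <= u.
Proof.
move=> [a Aa] sA hA.
have [z zE] := scincl_lower (leIl (i s) u).
have sz : s <= z.
  apply: (sup_lub sA) => x Ax; rewrite -(scincl_le S) zE lexI scincl_le.
  by rewrite (sup_ub sA)//= hA.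
by apply: le_trans (leIr u (i s)); rewrite -zE scincl_le.
Qed.

Lemma scincl_ge0 x : (czero <= i x) = (0 <= x).
Proof. by rewrite -(scincl0 S) scincl_le. Qed.

Lemma cscale_ge0 (k : R) u : 0 <= k -> czero <= u -> czero <= k *c u.
Proof. by move=> k0 u0; rewrite -(cscale_r0 S k0); apply: cle_scale. Qed.

Lemma caddr0 u : u +c czero = u.
Proof. by rewrite caddC cadd0l. Qed.

Lemma cscale_le (k l : R) u : 0 <= k -> k <= l -> czero <= u -> k *c u <= l *c u.
Proof.
move=> k0 kl u0; have lk : 0 <= l - k by rewrite subr_ge0.
have -> : l = k + (l - k) by ring.
rewrite cscaleDl// -[X in X <= _]caddr0; apply: cle_add.
exact: cscale_ge0.
Qed.

Lemma natinv_ge0 n : 0 <= (n.+1%:R^-1 : R).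
Proof. by rewrite invr_ge0. Qed.

Lemma natinv_le1 n : (n.+1%:R^-1 : R) <= 1.
Proof. by rewrite invf_le1// ler1n. Qed.

(* For [u >= 0], [cinf u] is infinite where [u] is, and [0] elsewhere. *)
Definition cinf u : S := infimum czero (range (fun n : nat => n.+1%:R^-1 *c u)).

Lemma cinfP u : czero <= u -> infimums (range (fun n : nat => n.+1%:R^-1 *c u)) (cinf u).
Proof.
move=> u0; have [||s hs] := @sc_inf_ex (range (fun n : nat => n.+1%:R^-1 *c u)).
- by exists (0.+1%:R^-1 *c u); exists 0%N.
- by move=> _ [n _ <-]; apply: cscale_ge0 => //; exact: natinv_ge0.
by rewrite /cinf (infimumE _ hs)//; exists (0.+1%:R^-1 *c u); exists 0%N.
Qed.

Lemma cinf_ge0 u : czero <= u -> czero <= cinf u.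
Proof.
move=> u0; have [_ h] := cinfP u0; apply: h => _ [n _ <-].
by apply: cscale_ge0 => //; exact: natinv_ge0.
Qed.

Lemma cinf_le u n : czero <= u -> cinf u <= n.+1%:R^-1 *c u.
Proof. by move=> u0; have [h _] := cinfP u0; apply: h; exists n. Qed.

Lemma le_cinf u w : czero <= u -> (forall n : nat, w <= n.+1%:R^-1 *c u) -> w <= cinf u.
Proof. by move=> u0 hw; have [_ h] := cinfP u0; apply: h => _ [n _ <-]. Qed.

Lemma cinf_le1 u : czero <= u -> cinf u <= u.
Proof. by move=> u0; have := cinf_le 0 u0; rewrite invr1 cscale1. Qed.

Lemma scincl_le_cinf u x : czero <= u ->
  (forall n : nat, i (n%:R *: x) <= u) -> i x <= cinf u.
Proof.
move=> u0 h; apply: le_cinf => // n.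
have := cle_scale _ _ _ (natinv_ge0 n) (h n.+1).
by rewrite scincl_scale// cscaleA ?natinv_ge0// mulVf ?pnatr_eq0// cscale1.
Qed.

Lemma scincl_cinf_mul u x (n k : nat) : czero <= u -> i x <= n%:R *c cinf u ->
  i (k%:R *: x) <= u.
Proof.
move=> u0 h.
have k0 : (0 : R) <= k%:R by [].
rewrite scincl_scale//; apply: (le_trans (cle_scale _ _ _ k0 h)).
rewrite cscaleA// -natrM.
(* [cinf u] is at most [u / (k n + 1)], so [k n] copies of it stay below [u]. *)
have := cle_scale _ _ _ (ler0n R (k * n)) (cinf_le (k * n) u0).
rewrite cscaleA ?natinv_ge0// => h1; apply: (le_trans h1).
rewrite -[X in _ <= X]cscale1; apply: cscale_le => //.
  by rewrite mulr_ge0// natinv_ge0.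
by rewrite ler_pdivrMr// mul1r ler_nat.
Qed.

End SupCompletionBasics.

Section SupInfBasics.
Variables (R : realType) (E : vectorLatticeType R) (S : supCompletion E).
Implicit Types (x y z : E) (u v w : S) (s t : supInf S) (A : set E).
Local Notation i := (scincl S).

Lemma sileE s t : (s <= t) = ((sipair s).1 <= (sipair t).1) && ((sipair t).2 <= (sipair s).2).
Proof. by []. Qed.

Lemma si_ge0 s : czero <= (sipair s).1 /\ czero <= (sipair s).2.
Proof. by case: s => -[u v] /= /and3P[]. Qed.

Lemma si_disj s : ((sipair s).1 `&` (sipair s).2)%O = czero.
Proof. by case: s => -[u v] /= /and3P[_ _ /eqP]. Qed.

Lemma sipair_opp s : sipair (siopp s) = ((sipair s).2, (sipair s).1).
Proof. by rewrite /siopp /= ifN ?opprK ?cscale1// oppr_ge0 -ltNge ltr01. Qed.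

Lemma sipair_scale (k : R) s : 0 <= k ->
  sipair (siscale k s) = (k *c (sipair s).1, k *c (sipair s).2).
Proof. by move=> k0; rewrite /= k0. Qed.

Lemma supinf_pred_le u v s : czero <= u -> czero <= v ->
  u <= (sipair s).1 -> v <= (sipair s).2 -> supinf_pred (u, v).
Proof.
move=> u0 v0 us vs; rewrite /supinf_pred /= u0 v0 /=; apply/eqP/le_anti.
by rewrite [X in _ && X]lexI u0 v0 andbT -(si_disj s) leI2.
Qed.

(** The order is reversed in the second coordinate. So the inner infimum turns the first coordinate
    into [cinf] and keeps the second at its largest value, attained at [n = 0]; the outer supremum
    does the opposite. *)
Lemma si_pminfty_pair s :
  sipair (si_pminfty s) = (cinf (sipair s).1, cinf (sipair s).2).
Proof.
have [u0 v0] := si_ge0 s; set u := (sipair s).1 in u0 *; set v := (sipair s).2 in v0 *.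
have ciu := cinf_le1 u0; have civ := cinf_le1 v0.
have ciu0 := cinf_ge0 u0; have civ0 := cinf_ge0 v0.
have p1 := supinf_pred_le ciu0 v0 ciu (lexx v).
have p2 := supinf_pred_le ciu0 civ0 ciu civ.
have scl (t : supInf S) n : sipair (siscale n.+1%:R^-1 t) =
   (n.+1%:R^-1 *c (sipair t).1, n.+1%:R^-1 *c (sipair t).2).
  by rewrite sipair_scale// natinv_ge0.
have scl1 n w : czero <= w -> n.+1%:R^-1 *c w <= w.
  move=> w0; rewrite -[X in _ <= X]cscale1.
  by apply: cscale_le; rewrite ?natinv_ge0 ?natinv_le1.
have e1 : infimum (si0 S) (range (fun n : nat => siscale n.+1%:R^-1 s)) = SupInf p1.
  apply: infimumE; last by exists (siscale 0.+1%:R^-1 s); exists 0%N.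
  split=> [_ [n _ <-]|t ht].
    by rewrite sileE scl /= cinf_le// scl1.
  rewrite sileE /=; apply/andP; split.
    apply: le_cinf => // n.
    have : t <= siscale n.+1%:R^-1 s by apply: ht; exists n.
    by rewrite sileE scl => /andP[].
  have : t <= siscale 0.+1%:R^-1 s by apply: ht; exists 0%N.
  by rewrite sileE scl invr1 /= !cscale1 => /andP[].
rewrite /si_pminfty e1.
suff -> : supremum (si0 S) (range (fun m : nat => siscale m.+1%:R^-1 (SupInf p1))) =
  SupInf p2 by [].
apply: supremumE; last by exists (siscale 0.+1%:R^-1 (SupInf p1)); exists 0%N.
split=> [_ [n _ <-]|t ht].
  by rewrite sileE scl /= scl1// cinf_le.
rewrite sileE /=; apply/andP; split.
  have : siscale 0.+1%:R^-1 (SupInf p1) <= t by apply: ht; exists 0%N.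
  by rewrite sileE scl invr1 /= !cscale1 => /andP[].
apply: le_cinf => // n.
have : siscale n.+1%:R^-1 (SupInf p1) <= t by apply: ht; exists n.
by rewrite sileE scl => /andP[].
Qed.

Lemma supremum2 d (T : porderType d) (x0 a b s : T) : (a <= s)%O -> (b <= s)%O ->
  (forall t : T, (a <= t)%O -> (b <= t)%O -> (s <= t)%O) -> supremum x0 [set a; b] = s.
Proof.
move=> sa sb h; apply: supremumE; last by exists a; left.
by split=> [x [->|->]//|t ht]; apply: h; apply: ht; [left|right].
Qed.

Lemma infimum2 d (T : porderType d) (x0 a b s : T) : (s <= a)%O -> (s <= b)%O ->
  (forall t : T, (t <= a)%O -> (t <= b)%O -> (t <= s)%O) -> infimum x0 [set a; b] = s.
Proof.
move=> sa sb h; apply: infimumE; last by exists a; left.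
by split=> [x [->|->]//|t ht]; apply: h; apply: ht; [left|right].
Qed.

Lemma sipair_pos s : sipair (sipos s) = ((sipair s).1, czero).
Proof.
have [u0 v0] := si_ge0 s.
have p := supinf_pred_le u0 (lexx czero) (lexx _) v0.
suff -> : sipos s = SupInf p by [].
apply: supremum2; rewrite ?sileE /= ?lexx ?u0 ?v0// => t.
by rewrite !sileE /= => /andP[-> _] /andP[_ ->].
Qed.

Lemma sipair_meet0 s : sipair (simeet s (si0 S)) = (czero, (sipair s).2).
Proof.
have [u0 v0] := si_ge0 s.
have p := supinf_pred_le (lexx czero) v0 u0 (lexx _).
suff -> : simeet s (si0 S) = SupInf p by [].
apply: infimum2; rewrite ?sileE /= ?lexx ?u0 ?v0// => t.
by rewrite !sileE /= => /andP[_ ->] /andP[-> _].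
Qed.

Lemma sipair_neg s : sipair (sineg s) = ((sipair s).2, czero).
Proof. by rewrite sipair_opp sipair_meet0. Qed.

Lemma sipair_pinfty s : sipair (si_pinfty s) = (cinf (sipair s).1, czero).
Proof. by rewrite sipair_pos si_pminfty_pair. Qed.

Lemma sipair_ninfty s : sipair (si_ninfty s) = (czero, cinf (sipair s).2).
Proof. by rewrite sipair_opp sipair_neg si_pminfty_pair. Qed.

Lemma siabs_pinfty s : (sipair (siabs (si_pinfty s))).1 = cinf (sipair s).1.
Proof.
have [u0 v0] := si_ge0 s; have c0 := cinf_ge0 u0.
suff -> : siabs (si_pinfty s) = si_pinfty s by rewrite sipair_pinfty.
apply: supremum2; rewrite ?sileE ?sipair_opp ?sipair_pinfty /= ?lexx ?c0// => t.
Qed.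

Lemma siabs_ninfty s : (sipair (siabs (si_ninfty s))).1 = cinf (sipair s).2.
Proof.
have [u0 v0] := si_ge0 s; have c0 := cinf_ge0 v0.
have e : sipair (siopp (si_ninfty s)) = (cinf (sipair s).2, czero).
  by rewrite (sipair_opp (si_ninfty s)) sipair_ninfty.
suff -> : siabs (si_ninfty s) = siopp (si_ninfty s) by rewrite e.
by apply: supremum2; rewrite ?sileE ?e ?sipair_ninfty /= ?lexx ?c0.
Qed.

Lemma sipair_incl x : sipair (si_incl S x) = (i (vpos x), i (vneg x)).
Proof.
rewrite /si_incl /si_of /= -(scincl0 S) -scincl_join -scincl_meet fin_part_scincl.
by rewrite vnegE.
Qed.

Lemma si_incl_inj x y : si_incl S x = si_incl S y -> x = y.
Proof.
move/(congr1 (@sipair _ _)); rewrite !sipair_incl => -[/scincl_inj e1 /scincl_inj e2].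
by rewrite -(vposBneg x) e1 e2 vposBneg.
Qed.

Lemma si_fin_incl x : si_fin (si_incl S x) = x.
Proof. by apply: xget_unique => // y; exact: si_incl_inj. Qed.

Lemma si_incl_le x y : x <= y -> si_incl S x <= si_incl S y.
Proof.
move=> xy; rewrite sileE !sipair_incl /= !scincl_le; apply/andP; split.
  by apply: vjoin_lub; [exact: le_trans xy (vjoinl _ _)|exact: vjoinr].
apply: vjoin_lub; last exact: vjoinr.
by apply: le_trans (vjoinl _ _); apply: (vle1 xy); linear_eq.
Qed.

Lemma sup_vpos A z : A !=set0 -> supremums A z -> supremums (@vpos _ _ @` A) (vpos z).
Proof.
move=> [a Aa] sA; split=> [_ [x Ax <-]|y hy].
  by apply: vjoin_lub; [exact: le_trans (sup_ub sA Ax) (vjoinl _ _)|exact: vjoinr].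
have hx x : A x -> vpos x <= y by move=> Ax; apply: hy; exists x.
apply: vjoin_lub; last exact: le_trans (vpos_ge0 a) (hx _ Aa).
by apply: (sup_lub sA) => x Ax; exact: le_trans (vpos_ge x) (hx _ Ax).
Qed.

Lemma supN A z : infimums A z -> supremums (-%R @` A) (- z).
Proof.
move=> sA; split => [_ [x Ax <-]|y yA].
  by apply: (vle1 (inf_lb sA Ax)); linear_eq.
have h : - y <= z.
  apply: (inf_glb sA) => x Ax; have : - x <= y by apply: yA; exists x.
  by move=> h; apply: (vle1 h); linear_eq.
by apply: (vle1 h); linear_eq.
Qed.

(** In coordinates this is an infimum of positive parts, settled by infinite distributivity in [E],
    and a supremum of negative parts, settled by [scincl_sup_le]. *)
Lemma si_incl_inf A z : A !=set0 -> infimums A z ->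
  infimums (si_incl S @` A) (si_incl S z).
Proof.
move=> [a Aa] iA; split=> [_ [x Ax <-]|t ht].
  exact: si_incl_le (inf_lb iA Ax).
have hx x : A x -> (sipair t).1 <= i (vpos x) /\ i (vneg x) <= (sipair t).2.
  move=> Ax; have : t <= si_incl S x by apply: ht; exists x.
  by rewrite sileE sipair_incl => /andP[].
rewrite sileE sipair_incl /=; apply/andP; split.
  have [l lE] := scincl_lower (hx _ Aa).1.
  rewrite -lE scincl_le; apply: (vjoin_inf_le iA) => x Ax.
  by rewrite -(scincl_le S) lE; exact: (hx _ Ax).1.
have NA0 : (-%R @` A) !=set0 by exists (- a); exists a.
have h1 := sup_vpos NA0 (supN iA).
apply: (scincl_sup_le _ h1); first by exists (vpos (- a)); exists (- a) => //; exists a.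
by move=> _ [_ [x Ax <-] <-]; exact: (hx _ Ax).2.
Qed.

Lemma si_incl_sup A z : A !=set0 -> supremums A z ->
  supremums (si_incl S @` A) (si_incl S z).
Proof.
move=> [a Aa] sA; split=> [_ [x Ax <-]|t ht].
  exact: si_incl_le (sup_ub sA Ax).
have hx x : A x -> i (vpos x) <= (sipair t).1 /\ (sipair t).2 <= i (vneg x).
  move=> Ax; have : si_incl S x <= t by apply: ht; exists x.
  by rewrite sileE sipair_incl => /andP[].
rewrite sileE sipair_incl /=; apply/andP; split.
  have A0 : A !=set0 by exists a.
  apply: (scincl_sup_le _ (sup_vpos A0 sA)); first by exists (vpos a); exists a.
  by move=> _ [x Ax <-]; exact: (hx _ Ax).1.
have [l lE] := scincl_lower (hx _ Aa).2.
rewrite -lE scincl_le; apply: (vjoin_inf_le (infN sA)) => _ [x Ax <-].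
by rewrite -(scincl_le S) lE; exact: (hx _ Ax).2.
Qed.

(** The truncation of [x] at [w]; it stays in [E] because elements of [E^s] below an element of [E]
    are in [E]. *)
Definition cap x w : E := fin_part (i x `&` w)%O.

Lemma capE x w : i (cap x w) = (i x `&` w)%O.
Proof. exact: (fin_partK (leIl _ _)). Qed.

Lemma cap_ge0 x w : 0 <= x -> czero <= w -> 0 <= cap x w.
Proof. by move=> x0 w0; rewrite -(scincl_le S) capE scincl0 lexI w0 scincl_ge0 x0. Qed.

Lemma cap_le x w : cap x w <= x.
Proof. by rewrite -(scincl_le S) capE leIl. Qed.

Lemma le_cap x y w : y <= x -> i y <= w -> y <= cap x w.
Proof. by move=> yx yw; rewrite -(scincl_le S) capE lexI yw scincl_le yx. Qed.

Lemma lower_posE s u : sipair s = (u, czero) ->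
  lower_pos s = [set x | 0 <= x /\ i x <= u].
Proof.
move=> su; apply/seteqP; split=> x /= [x0].
  by rewrite sileE sipair_incl su /= vpos_id// => /andP[].
by move=> xu; split => //; rewrite sileE sipair_incl su /= vpos_id// vneg_id// xu scincl0 /=.
Qed.

Lemma si_fin_meet x t w : 0 <= x -> sipair t = (w, czero) ->
  si_fin (simeet (si_incl S x) t) = cap x w.
Proof.
move=> x0 tw; have w0 : czero <= w by have [] := si_ge0 t; rewrite tw.
suff -> : simeet (si_incl S x) t = si_incl S (cap x w) by exact: si_fin_incl.
have c0 := cap_ge0 x0 w0.
have e (y : E) : 0 <= y -> sipair (si_incl S y) = (i y, czero).
  by move=> y0; rewrite sipair_incl vpos_id// vneg_id// scincl0.
apply: infimum2; rewrite ?sileE ?e// ?tw /= ?capE ?leIl ?leIr ?lexx// => r.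
by rewrite !sileE !e// tw /= capE lexI => /andP[-> ->] /andP[->].
Qed.

(** Subtracting the truncation at [cinf w] removes what lies where [w] is infinite; the supremum of
    these elements is the finite part of [w]. *)
Definition finite_elts w : set E :=
  [set x - cap x (cinf w) | x in [set x | 0 <= x /\ i x <= w]].

(** Once both suprema exist in [E], the nested infimum and supremum defining [finite_part] are
    images of ones taken in [E]. *)
Lemma finite_part_sup s a b :
  supremums (finite_elts (sipair s).1) a -> supremums (finite_elts (sipair s).2) b ->
  finite_part s = a - b.
Proof.
have [u0 v0] := si_ge0 s.
move=> ha hb; rewrite /finite_part.
rewrite (lower_posE (sipair_pos s)) (lower_posE (sipair_neg s)).
set X := [set infimum _ _ | x in _].
have zero w : czero <= w -> 0 <= (0 : E) /\ i 0 <= w by rewrite scincl0.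
have ne w : czero <= w -> finite_elts w !=set0.
  by move=> w0; exists (0 - cap 0 (cinf w)); exists 0 => //=; exact: zero.
have neim (B : set E) (f : E -> E) : B !=set0 -> f @` B !=set0.
  by move=> [y By]; exists (f y); exists y.
have neim' (B : set E) : B !=set0 -> si_incl S @` B !=set0.
  by move=> [y By]; exists (si_incl S y); exists y.
suff -> : X = si_incl S @` [set y - b | y in finite_elts (sipair s).1].
  have h : supremums [set y - b | y in finite_elts (sipair s).1] (a - b).
    split=> [_ [y hy <-]|z hz]; first by apply: (vle1 (sup_ub ha hy)); linear_eq.
    have h : a <= z + b.
      apply: (sup_lub ha) => y hy; have : y - b <= z by apply: hz; exists y.
      by move=> h; apply: (vle1 h); linear_eq.
    by apply: (vle1 h); linear_eq.
  have ne1 := neim _ (fun y => y - b) (ne _ u0).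
  by rewrite (supremumE _ (si_incl_sup ne1 h) (neim' _ ne1)) si_fin_incl.
rewrite /X /finite_elts !image_comp; apply: eq_imagel => x /= [x0 xu].
rewrite (si_fin_meet x0 (sipair_pinfty s)); set fx := x - _.
set Y := [set si_incl S _ | y in _].
suff -> : Y = si_incl S @` [set fx - y | y in finite_elts (sipair s).2].
  have h : infimums [set fx - y | y in finite_elts (sipair s).2] (fx - b).
    split=> [_ [y hy <-]|z hz]; first by apply: (vle1 (sup_ub hb hy)); linear_eq.
    have h : b <= fx - z.
      apply: (sup_lub hb) => y hy; have : z <= fx - y by apply: hz; exists y.
      by move=> h; apply: (vle1 h); linear_eq.
    by apply: (vle1 h); linear_eq.
  have ne1 := neim _ (fun y => fx - y) (ne _ v0).
  by rewrite (infimumE _ (si_incl_inf ne1 h) (neim' _ ne1)).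
rewrite /Y /finite_elts !image_comp; apply: eq_imagel => y /= [y0 yv].
have op : sipair (siopp (si_ninfty s)) = (cinf (sipair s).2, czero).
  by rewrite (sipair_opp (si_ninfty s)) sipair_ninfty.
by rewrite (si_fin_meet y0 op).
Qed.

End SupInfBasics.

(** * Open intervals *)

Section OpenInterval.
Variables (R : realType) (E : fAlgebraType R) (S : supCompletion E).
Hypothesis Ecomp : universally_complete E.
Implicit Types (x y z a b c d p q r m n : E) (u v w : S) (s t : supInf S) (A : set E).
Local Notation i := (scincl S).

(** By gluing, a bound on some nonzero part of each [p] is enough. Either the elements below [u] are
    bounded by some [n] on a part of [p], or [u] is infinite on all of [p] and finite elements are
    at most [0] there. *)
Lemma finite_elts_bounded u : czero <= u ->
  exists m, forall x, finite_elts u x -> x <= m.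
Proof.
move=> u0.
pose D := [set q | component q /\ exists m, forall x, finite_elts u x -> q ** x <= m].
have [q []//|p cp pn0|A AD cA] := @exhaustion _ _ Ecomp D; last first.
  have /choice[f hf] q : exists m, A q -> forall x, finite_elts u x -> q ** x <= m.
    have [/AD[_ [m hm]]|nA] := pselect (A q); first by exists m.
    by exists 0.
  have [m hm] := patch_comp Ecomp f cA.
  exists m => x hx; apply: (part_le cA) => q Aq; have [cq _] := AD _ Aq.
  rewrite hm// -(comp_idemA cq); apply: fmul_lel; first exact: comp_ge0.
  exact: hf.
have p0 := comp_ge0 cp.
have [[n [q [cq qn0 qp hq]]]|H] := pselect (exists (n : nat) q,
   [/\ component q, q != 0, q ** p = q &
     forall x, 0 <= x -> i x <= u -> q ** vpos (x - n%:R *: fone) = 0]).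
  exists q; split => //; split => //; exists (n%:R *: fone) => _ [x [x0 xu] <-].
  have q0 := comp_ge0 cq.
  have h1 := fmul_lel q0 (vpos_ge (x - n%:R *: fone)); rewrite hq// in h1.
  have h2 := cap_ge0 x0 (cinf_ge0 u0).
  have h3 := fmul_lel q0 (vle1 h2 _ : x - cap x (cinf u) <= x).
  have h4 : n%:R *: q <= n%:R *: fone by apply: vle_scale => //; exact: comp_le1.
  apply: (le_trans (h3 _)); first by linear_eq.
  by rewrite fmulBr fmulZr fmul1r in h1; apply: (vle2 h1 h4); linear_eq.
(* In the second case, every part of [p] contains a smaller part [r] on which some element below [u]
   exceeds [n]; the supremum [t] of the pieces [n%:R *: r] is below [u] and fills up [n%:R *: p]. *)
have np (n : nat) : i (n%:R *: p) <= u.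
  have n0 : (0 : R) <= n%:R by [].
  pose W := [set y | y = 0 \/ exists r x, [/\ component r, r ** p = r, i x <= u,
     n%:R *: r <= x & y = n%:R *: r]].
  have W0 : W 0 by left.
  have [||t ht] := @dedekind_sup _ _ Ecomp W; first by exists 0.
    exists (n%:R *: fone) => y [->|[r [x [cr _ _ _ ->]]]].
      by rewrite vscale_ge0// fone_ge0.
    by apply: vle_scale => //; exact: comp_le1.
  have tu : i t <= u.
    apply: (scincl_sup_le _ ht); first by exists 0.
    move=> y [->|[r [x [_ _ xu rx ->]]]]; first by rewrite scincl0.
    by apply: le_trans xu; rewrite scincl_le.
  have t0 : 0 <= t by exact: (sup_ub ht).
  suff h : n%:R *: p - t <= 0.
    by apply: le_trans tu; rewrite scincl_le; apply: (vle1 h); linear_eq.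
  apply: (le0_local Ecomp) => p' cp' p'n0.
  have [pp0|pp0] := eqVneq (p' ** p) 0.
    exists p'; split => //; first exact: comp_idem.
    rewrite fmulBr fmulZr pp0 scaler0 sub0r.
    have h : 0 <= p' ** t by rewrite fmul_ge0// comp_ge0.
    by apply: (vle1 h); linear_eq.
  have cpp := comp_mul cp' cp.
  have [x [xu hx]] : exists x, i x <= u /\ (p' ** p) ** vpos (x - n%:R *: fone) != 0.
    apply: contrapT => nx; apply: H; exists n, (p' ** p); split => //.
      by rewrite -fmulA comp_idem.
    by move=> x x0 xu; apply: contrapT => /eqP h; apply: nx; exists x.
  have w0 : 0 <= (p' ** p) ** vpos (x - n%:R *: fone).
    by rewrite fmul_ge0 ?vpos_ge0// comp_ge0.
  have [r [cr rw rd]] := support_ex Ecomp w0; set w := _ ** _ in w0 rw rd hx.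
  have r0 := comp_ge0 cr.
  have rn0 : r != 0 by apply: contraNneq hx => r0'; rewrite -rw r0' fmul0l.
  have rpp : r ** (p' ** p) = r.
    by apply: support_below rd => //; exact: comp_CmulA0.
  have rp : r ** p = r by rewrite -{1}rpp -!fmulA comp_idem.
  have rp' : r ** p' = r.
    by rewrite -{1}rpp (fmulC Ecomp p' p) -!fmulA (comp_idem cp') (fmulC Ecomp p) rpp.
  have rx : n%:R *: r <= r ** x.
    have h : r ** vneg (x - n%:R *: fone) = 0.
      apply: rd; apply: fmul_disjl; last exact: comp_ge0.
      exact: vpos_neg_disj.
    have h2 : 0 <= r ** vpos (x - n%:R *: fone) by rewrite fmul_ge0// vpos_ge0.
    have : 0 <= r ** (x - n%:R *: fone).
      by rewrite -[X in r ** X]vposBneg fmulBr h subr0.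
    by rewrite fmulBr fmulZr fmul1r => h3; apply: (vle1 h3); linear_eq.
  exists r; split => //.
  have h : n%:R *: r <= t.
    apply: (sup_ub ht); right; exists r, (n%:R *: r); split => //.
    have h1 : n%:R *: r <= vpos x.
      apply: (le_trans rx).
      apply: (le_trans (fmul_lel r0 (vpos_ge x))).
      exact: comp_mull_le (vpos_ge0 _).
    apply: (@le_trans _ _ (i (vpos x))); first by rewrite scincl_le.
    by rewrite /vpos scincl_join leUx xu scincl0.
  have := fmul_lel r0 h; rewrite fmulBr !fmulZr rp comp_idem// => h1.
  by apply: (vle1 h1); linear_eq.
have kp (k : nat) : i (k%:R *: p) <= cinf u.
  by apply: scincl_le_cinf => // n; rewrite scalerA -natrM.
exists p; split => //; last exact: comp_idem.
split => //; exists 0 => _ [x [x0 xu] <-].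
apply: (@arch_le0 _ _ Ecomp _ (p ** (x ** x))) => k.
have k0 : (0 : R) <= k%:R by [].
(* As [cinf u] dominates [k%:R *: p], what remains of [x] on [p] is at most [(x - k)^+], whose
   [k]-fold is at most [x ** x]. *)
have h1 : vmeet x (k%:R *: p) <= cap x (cinf u).
  apply: le_cap; first exact: vmeetl.
  by apply: le_trans (kp k); rewrite scincl_le; exact: vmeetr.
have h2 : p ** (x - cap x (cinf u)) <= p ** vpos (x - k%:R *: fone).
  have -> : p ** vpos (x - k%:R *: fone) = p ** (x - vmeet x (k%:R *: p)).
    rewrite vsub_meetE !fmul_pos// !fmulBr !fmulZr comp_idem// fmul1r//.
  by apply: fmul_lel => //; apply: (vle1 h1); linear_eq.
apply: (le_trans (vle_scale _ _ _ k0 h2)).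
by rewrite -fmulZr; apply: fmul_lel => //; exact: fmul_trunc.
Qed.

Lemma finite_elts_sup u : czero <= u -> exists a, supremums (finite_elts u) a.
Proof.
move=> u0; apply: (dedekind_sup Ecomp); last exact: finite_elts_bounded.
exists (0 - cap 0 (cinf u)); exists 0 => //=; split => //.
by rewrite scincl0.
Qed.

Lemma cap_cinf_scincl x n : 0 <= n -> 0 <= x -> cap x (cinf (i n)) = 0.
Proof.
move=> n0 x0; have n0' : czero <= i n by rewrite scincl_ge0.
apply: le_anti; apply/andP; split; last by apply: cap_ge0 => //; exact: cinf_ge0.
apply: (@arch_inv_le0 _ _ Ecomp _ n) => k.
rewrite -(scincl_le S) capE scincl_scale ?natinv_ge0//.
by apply: le_trans (cinf_le k n0'); exact: leIr.
Qed.

Lemma finite_elts_scincl n : 0 <= n -> supremums (finite_elts (i n)) n.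
Proof.
move=> n0; split=> [_ [x [x0 xn] <-]|y hy].
  by rewrite cap_cinf_scincl// subr0 -(scincl_le S).
apply: hy; exists n => //=; by rewrite cap_cinf_scincl// subr0.
Qed.

Lemma finite_elts_le p u m a : component p -> 
  (forall x, 0 <= x -> i x <= u -> p ** x <= m) -> czero <= u ->
  supremums (finite_elts u) a -> p ** a <= p ** m.
Proof.
move=> cp h u0 ha; have p0 := comp_ge0 cp.
(* Nothing is known off [p], so [a] itself serves as the bound there. *)
suff : a <= p ** m + (fone - p) ** a.
  move=> /(fmul_lel p0); by rewrite fmulDr comp_idemA// comp_mulCA0// addr0.
apply: (sup_lub ha) => x hx.
rewrite -[x in x <= _](comp_split p x).
have h1 : (fone - p) ** x <= (fone - p) ** a.
  by apply: fmul_lel; [exact: comp_compl_ge0|exact: (sup_ub ha)].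
have h2 : p ** x <= p ** m.
  case: hx => y [y0 yu] <-.
  have c0 := cap_ge0 y0 (cinf_ge0 u0).
  rewrite -[X in X <= _](comp_idemA cp); apply: fmul_lel => //.
  apply: le_trans (h _ y0 yu); apply: fmul_lel => //.
  by apply: (vle1 c0); linear_eq.
by apply: (vle2 h1 h2); linear_eq.
Qed.

(** An element below a multiple of [cinf u] has all its multiples below [u]; where these are bounded
    by [m], the element vanishes. *)
Lemma comp_disj_cproj p u m : component p -> czero <= u ->
  (forall x, 0 <= x -> i x <= u -> p ** x <= m) ->
  disj_compl [set x | cproj (cinf u) x = x] p.
Proof.
move=> cp u0 h; have p0 := comp_ge0 cp.
have c0 := cinf_ge0 u0.
pose P z := fin_part
    (supremum czero (range (fun n : nat => (i z `&` n%:R *c cinf u)%O))).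
have hP z : 0 <= z -> p ** P z = 0.
  move=> z0; pose B := range (fun n : nat => (i z `&` n%:R *c cinf u)%O).
  have ne : B !=set0 by exists (i z `&` 0%:R *c cinf u)%O; exists 0%N.
  have [y hy] := sc_sup_ex ne.
  have yE : i (P z) = y.
    rewrite /P (supremumE _ hy ne); apply: (@fin_partK _ _ _ _ z).
    by case: hy => _; apply => _ [n _ <-]; exact: leIl.
  have Pz0 : 0 <= P z.
    rewrite -(scincl_ge0 S) yE; case: hy => + _ => hy; apply: hy; exists 0%N => //.
    by rewrite cscale0; apply: meet_r; rewrite scincl_ge0.
  have h2 : P z <= (fone - p) ** z.
    rewrite -(scincl_le S) yE; case: hy => _; apply => _ [n _ <-].
    have e := capE z (n%:R *c cinf u); rewrite -e scincl_le.
    set z' := cap _ _ in e *.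
    have z'0 : 0 <= z' by apply: cap_ge0 => //; exact: cscale_ge0.
    have pz' : p ** z' = 0.
      apply: le_anti; rewrite [X in _ && X]fmul_ge0// andbT.
      apply: (@arch_le0 _ _ Ecomp _ m) => k.
      rewrite -fmulZr; apply: h; first exact: vscale_ge0.
      by apply: (scincl_cinf_mul (n := n)) => //; rewrite e leIr.
    have -> : z' = (fone - p) ** z' by rewrite fmulBl fmul1l pz' subr0.
    apply: fmul_lel; first exact: comp_compl_ge0.
    exact: cap_le.
  apply: le_anti; rewrite [X in _ && X]fmul_ge0// andbT.
  by have := fmul_lel p0 h2; rewrite comp_mulCA0.
move=> x /= hx; rewrite vabs_id//; apply: comp_mul0_disj => //; first exact: vabs_ge0.
rewrite fmul_abs// -hx /cproj -!/(P _) fmulBr !hP ?vpos_ge0 ?vneg_ge0// subrr.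
exact: vabs0.
Qed.

Lemma disj_compl_mul A p x : component p -> disj_compl A p -> disj_compl A (p ** x).
Proof.
move=> cp hp y Ay; have := hp y Ay; rewrite vabs_id ?comp_ge0// => h.
by rewrite -fmul_abs ?comp_ge0//; apply: fmul_disjr => //; exact: vabs_ge0.
Qed.

Lemma band_proj_disj_compl A p z : component p -> disj_compl A p ->
  p ** band_proj (disj_compl A) z = p ** z.
Proof.
move=> cp; have [q cq ->] := disj_compl_ex Ecomp A.
by rewrite /= band_proj_comp// => hq; rewrite fmulA (fmulC Ecomp p) hq.
Qed.

(** The negative part [n] of [w] is finite because the meet of [w] and [0] is below [0]; the last
    clause reads [w] as its positive part minus [n]. *)
Lemma sipair_si_of w : exists n, [/\ 0 <= n,
  sipair (si_of w) = ((w `|` czero)%O, i n) &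
  forall x, i x <= (w `|` czero)%O -> i (x - n) <= w].
Proof.
have wl : (w `&` czero)%O <= i 0 by rewrite scincl0 leIr.
exists (- fin_part (w `&` czero)%O); split => //.
  have : fin_part (w `&` czero)%O <= 0 by rewrite -(scincl_le S) (fin_partK wl).
  by move=> h; apply: (vle1 h); linear_eq.
move=> x xw; rewrite opprK; set z := fin_part _.
have zE : i z = (w `&` czero)%O by exact: fin_partK wl.
have z0 : z <= 0 by rewrite -(scincl_le S) zE.
have Nz0 : czero <= i (- z) by rewrite scincl_ge0; apply: (vle1 z0); linear_eq.
rewrite addrC scincl_add; apply: (le_trans (cle_add _ _ (i z) xw)).
have zK : w = i z +c (i (- z) +c w) by rewrite caddA -scincl_add addrN scincl0 cadd0l.
rewrite {2}zK; apply: cle_add; rewrite leUx; apply/andP; split.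
  by have := cle_add _ _ w Nz0; rewrite caddr0 caddC.
have := cle_add _ _ (i (- z)) (leIl w czero); rewrite -zE -scincl_add addNr.
by rewrite scincl0.
Qed.

Lemma siband_d_pinfty s p m : component p ->
  (forall x, 0 <= x -> i x <= (sipair s).1 -> p ** x <= m) ->
  siband_d (si_pinfty s) p.
Proof.
move=> cp h; rewrite /siband_d /siband /siproj siabs_pinfty.
by apply: (comp_disj_cproj cp _ h); have [] := si_ge0 s.
Qed.

Lemma siband_d_ninfty s p m : component p ->
  (forall x, 0 <= x -> i x <= (sipair s).2 -> p ** x <= m) ->
  siband_d (si_ninfty s) p.
Proof.
move=> cp h; rewrite /siband_d /siband /siproj siabs_ninfty.
by apply: (comp_disj_cproj cp _ h); have [] := si_ge0 s.
Qed.

Lemma finite_part_opp s : finite_part (siopp s) = - finite_part s.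
Proof.
have [u0 v0] := si_ge0 s.
have [a ha] := finite_elts_sup u0; have [b hb] := finite_elts_sup v0.
rewrite (finite_part_sup ha hb) (@finite_part_sup _ _ _ _ b a) ?sipair_opp//.
linear_eq.
Qed.

Lemma finite_part_incl a : finite_part (si_incl S a) = a.
Proof.
rewrite (@finite_part_sup _ _ _ _ (vpos a) (vneg a)) ?vposBneg// sipair_incl.
  by apply: finite_elts_scincl; exact: vpos_ge0.
by apply: finite_elts_scincl; exact: vneg_ge0.
Qed.

Lemma siband_d_incl a p : component p ->
  siband_d (si_pinfty (si_incl S a)) p /\ siband_d (si_ninfty (si_incl S a)) p.
Proof.
move=> cp; have p0 := comp_ge0 cp; split.
  apply: (@siband_d_pinfty _ _ (p ** vpos a)) => // x _.
  by rewrite sipair_incl scincl_le => h; exact: fmul_lel.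
apply: (@siband_d_ninfty _ _ (p ** vneg a)) => // x _.
by rewrite sipair_incl scincl_le => h; exact: fmul_lel.
Qed.

(** Adding the finite negative part [n] turns the bound [m] for [w] on [p] into the bound [m + n]
    for its positive part. *)
Lemma si_of_bound w p m : component p -> (forall x, i x <= w -> p ** x <= p ** m) ->
  siband_d (si_pinfty (si_of w)) p /\ p ** finite_part (si_of w) <= p ** m.
Proof.
move=> cp h; have [n [n0 e hn]] := sipair_si_of w.
have hu x : 0 <= x -> i x <= (sipair (si_of w)).1 -> p ** x <= p ** (m + n).
  move=> x0; rewrite e => /hn/h; rewrite fmulBr fmulDr => h1.
  by apply: (vle1 h1); linear_eq.
split; first exact: siband_d_pinfty hu.
have [u0 v0] := si_ge0 (si_of w).
have [a ha] := finite_elts_sup u0.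
have hb : supremums (finite_elts (sipair (si_of w)).2) n.
  by rewrite e; exact: finite_elts_scincl.
rewrite (finite_part_sup ha hb) fmulBr.
have := finite_elts_le cp hu u0 ha; rewrite comp_idemA// fmulDr => h1.
by apply: (vle1 h1); linear_eq.
Qed.

Lemma si_of_opp_bound w p m : component p -> (forall x, i x <= w -> p ** x <= p ** m) ->
  siband_d (si_ninfty (siopp (si_of w))) p /\
  - (p ** m) <= p ** finite_part (siopp (si_of w)).
Proof.
move=> cp h; have [_ h2] := si_of_bound cp h; split; last first.
  by rewrite finite_part_opp fmulNr; apply: (vle1 h2); linear_eq.
have [n [n0 e hn]] := sipair_si_of w.
apply: (@siband_d_ninfty _ _ (p ** (m + n))) => // x x0.
rewrite sipair_opp e /= => /hn/h; rewrite fmulBr fmulDr => h1.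
by apply: (vle1 h1); linear_eq.
Qed.

Lemma vabs_disj z : vmeet (vabs z + z) (vabs z - z) = 0.
Proof.
rewrite -[X in vmeet (_ + X)](vposBneg z) -[X in vmeet _ (_ - X)](vposBneg z) vabsE.
have -> : vpos z + vneg z + (vpos z - vneg z) = 2 *: vpos z by linear_eq.
have -> : vpos z + vneg z - (vpos z - vneg z) = 2 *: vneg z by linear_eq.
have h : vmeet (2 *: vpos z) (vneg z) = 0.
  by apply: vdisj_scale; rewrite ?vpos_ge0 ?vneg_ge0// vpos_neg_disj.
rewrite vmeetC; apply: vdisj_scale; rewrite ?vscale_ge0 ?vpos_ge0 ?vneg_ge0//.
by rewrite vmeetC.
Qed.

(* On a component [p] where [rho <= |a - c|], the two weak order units coming from
   [c - rho << a] and [a << c + rho] are disjoint, so that [p = 0]. *)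
Lemma open_interval_comp c (rho : S) a p : component p ->
  (forall x, i x <= rho -> p ** x <= p ** vabs (a - c)) ->
  in_open_interval c rho a -> p = 0.
Proof.
move=> cp hp [[_ _ wu1] [_ _ wu2]]; have p0 := comp_ge0 cp.
set d := vabs (a - c) in hp.
have shift x b : i x <= rho +c i b -> i (x - b) <= rho.
  move=> /(cle_add _ _ (i (- b))); rewrite -scincl_add [- b + x]addrC => h.
  apply: (le_trans h); rewrite caddC -caddA -scincl_add addrN scincl0.
  by rewrite caddr0.
have h1 x : i x <= rho +c i (- c) -> p ** x <= p ** (d - c).
  move=> /shift/hp; rewrite opprK !(fmulDr, fmulNr) => h.
  by apply: (vle1 h); linear_eq.
have h2 x : i x <= i c +c rho -> p ** x <= p ** (d + c).
  rewrite caddC => /shift/hp; rewrite !(fmulDr, fmulNr) => h.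
  by apply: (vle1 h); linear_eq.
have [b1 f1] := si_of_opp_bound cp h1; have [b2 f2] := si_of_bound cp h2.
have [b3 b4] := siband_d_incl a cp.
have proj s t z : siband_d s p -> siband_d t p ->
    p ** siproj_d s (siproj_d t z) = p ** z.
  by move=> hs ht; rewrite /siproj_d /siband_d !band_proj_disj_compl.
have e1 := proj _ _ (finite_part (si_incl S a) -
  finite_part (siopp (si_of (rho +c i (- c))))) b1 b3.
have e2 := proj _ _ (finite_part (si_of (i c +c rho)) -
  finite_part (si_incl S a)) b4 b2.
case: wu1 => _; move: (siproj_d _ _) e1 => w1; rewrite finite_part_incl => e1 w10 wu1.
case: wu2 => _; move: (siproj_d _ _) e2 => w2; rewrite finite_part_incl => e2 w20 wu2.
have p1 : 0 <= p ** w1 by exact: fmul_ge0.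
have p2 : 0 <= p ** w2 by exact: fmul_ge0.
have dd : vmeet (p ** w1) (p ** w2) = 0.
  apply: le_anti; rewrite [X in _ && X]vmeet_ge0// andbT.
  have <- : p ** vmeet (d + (a - c)) (d - (a - c)) = 0 by rewrite vabs_disj fmul0r.
  rewrite fmul_meet// e1 e2; apply: vmeet_mono.
    by apply: (vle1 f1); rewrite !(fmulDr, fmulNr); linear_eq.
  by apply: (vle1 f2); rewrite !(fmulDr, fmulNr); linear_eq.
(* [p ** w1] is disjoint from the weak order unit [w2], hence zero; then [p] itself is disjoint from
   the weak order unit [w1]. *)
have pw1 : p ** w1 = 0.
  apply: (wu2 _ _ p1).
    by split; [exact: (disj_compl_mul _ cp b4)|exact: (disj_compl_mul _ cp b2)].
  rewrite -[w2](comp_split p) vmeetC.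
  have q2 : 0 <= (fone - p) ** w2 by rewrite fmul_ge0// comp_compl_ge0.
  by apply: vdisj_add => //; rewrite vmeetC//; exact: comp_disj.
by apply: (wu1 _ _ p0); [split; [exact: b1|exact: b3]|exact: comp_mul0_disj].
Qed.

(** The axiom [sc_meet_sup], applied to the image of [A] and the singleton of its supremum, makes
    [x] the supremum of its truncations by elements of [A]. *)
Lemma le_sup_meet A x b : A !=set0 -> i x <= supremum czero (i @` A) ->
  (forall r, A r -> vmeet r x <= b) -> x <= b.
Proof.
move=> [r Ar]; set rho := supremum _ _ => xr h.
have iA0 : i @` A !=set0 by exists (i r); exists r.
have R0 : [set rho] !=set0 by exists rho.
have := sc_meet_sup iA0 R0; rewrite supremum1 => /(_ erefl x).
have -> : [set (y `&` i x)%O | y in [set rho]] = [set i x].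
  apply/seteqP; split => [_ [_ -> <-]|_ ->]; first exact: meet_r.
  by exists rho => //; exact: meet_r.
rewrite supremum1 => e; rewrite -(scincl_le S) -e.
have ne : [set (y `&` i x)%O | y in i @` A] !=set0.
  by exists (i r `&` i x)%O; exists (i r) => //; exists r.
have [s sP] := sc_sup_ex ne; rewrite (supremumE _ sP ne).
case: sP => _; apply => _ [_ [y Ay <-] <-].
by rewrite -scincl_meet scincl_le; exact: h.
Qed.

Lemma spectrum_open_interval (f : nat -> E -> E) c rho a : local_series f ->
  spectrum_cvg f c 0 -> radius_cvg S f c = rho -> in_open_interval c rho a ->
  spectrum_cvg f c (vabs (a - c)).
Proof.
move=> lf f0 <- ha; apply: (spectrum_local Ecomp lf) => [|p cp pn0].
  exact: vabs_ge0.
apply: contrapT => H; case/eqP: pn0.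
have p0 := comp_ge0 cp.
apply: (open_interval_comp cp _ ha) => x xr.
set d := vabs (a - c).
suff : x <= p ** d + (fone - p) ** x.
  by move=> /(fmul_lel p0); rewrite fmulDr comp_idemA// comp_mulCA0// addr0.
apply: (@le_sup_meet (spectrum_cvg f c)) xr _; first by exists 0.
move=> r fr; have r0 : 0 <= r by case: fr.
(* Otherwise the support [q] of [(r - d)^+] on [p] is nonzero and [d <= r] holds on it, against
   [H]. *)
suff pr : p ** r <= p ** d.
  rewrite -[vmeet r x](comp_split p).
  have k1 := fmul_lel p0 (vmeetl r x).
  have k2 := fmul_lel (comp_compl_ge0 cp) (vmeetr r x).
  by apply: (vle3 k1 k2 pr); linear_eq.
have w0 : 0 <= p ** vpos (r - d) by rewrite fmul_ge0// vpos_ge0.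
have [q [cq qw qd]] := support_ex Ecomp w0.
suff q0 : q = 0.
  move: qw; rewrite q0 fmul0l => e.
  have := fmul_lel p0 (vpos_ge (r - d)); rewrite -e fmulBr => h.
  by apply: (vle1 h); linear_eq.
apply: contrapT => /eqP qn0; apply: H; exists q, r; split => //.
  by apply: support_below qd => //; exact: comp_CmulA0.
have qn : q ** vneg (r - d) = 0 by apply: qd; apply: fmul_disjl => //; exact: vpos_neg_disj.
have : 0 <= q ** (r - d).
  by rewrite -[X in q ** X]vposBneg fmulBr qn subr0 fmul_ge0 ?vpos_ge0// comp_ge0.
by rewrite fmulBr => h; apply: (vle1 h); linear_eq.
Qed.

(** On a given [p], either [d] exceeds [d'] on a nonzero part, where the join is [d], or the join is
    [d'] on all of [p]. *)
Lemma spectrum_join (f : nat -> E -> E) c d d' : local_series f ->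
  spectrum_cvg f c d -> spectrum_cvg f c d' -> spectrum_cvg f c (vjoin d d').
Proof.
move=> lf hd hd'; apply: (spectrum_local Ecomp lf) => [|p cp pn0].
  by apply: le_trans (vjoinl _ _); case: hd.
have p0 := comp_ge0 cp.
have w0 : 0 <= p ** vpos (d - d') by rewrite fmul_ge0// vpos_ge0.
have [q [cq qw qd]] := support_ex Ecomp w0; have q0 := comp_ge0 cq.
have [qe|qn0] := eqVneq q 0.
  exists p, d'; split => //; first exact: comp_idem.
  rewrite fmul_join//; apply: vjoin_lub => //.
  move: qw; rewrite qe fmul0l => e.
  have := fmul_lel p0 (vpos_ge (d - d')); rewrite -e fmulBr => h.
  by apply: (vle1 h); linear_eq.
exists q, d; split => //.
  by apply: support_below qd => //; exact: comp_CmulA0.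
rewrite fmul_join//; apply: vjoin_lub => //.
have qn : q ** vneg (d - d') = 0 by apply: qd; apply: fmul_disjl => //; exact: vpos_neg_disj.
have : 0 <= q ** (d - d').
  by rewrite -[X in q ** X]vposBneg fmulBr qn subr0 fmul_ge0 ?vpos_ge0.
by rewrite fmulBr => h; apply: (vle1 h); linear_eq.
Qed.

End OpenInterval.

(** * Power series and their integrals *)

(* [E] itself carries no ring structure of the library; the alias makes [ring] apply. *)
Definition fring (R : realType) (E : fAlgebraType R) of universally_complete E : Type := E.

Section FRing.
Variables (R : realType) (E : fAlgebraType R) (Ecomp : universally_complete E).
HB.instance Definition _ := GRing.Zmodule.copy (fring Ecomp) E.
HB.instance Definition _ := GRing.Zmodule_isComPzRing.Build (fring Ecomp)
  (@fmulA R E) (@fmulC R E Ecomp) (@fmul1l R E) (@fmulDl R E).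

Lemma fmul_fring (x y : E) : x ** y = (x : fring Ecomp) * y. Proof. by []. Qed.
End FRing.

Ltac fring_eq H :=
  rewrite !(fmul_fring H);
  match goal with |- @eq _ ?a ?b => change (@eq (fring H) a b) end;
  ring.

Section PowerSeries.
Variables (R : realType) (E : fAlgebraType R).
Hypothesis Ecomp : universally_complete E.
Implicit Types (x y z a b c d p q r s t h w K M : E) (coef : nat -> E).

(** Turns scalars into ring elements, for [fring_eq]. *)
Lemma fscale_one (k : R) x : k *: x = (k *: fone) ** x.
Proof. by rewrite fmulZl fmul1l. Qed.

Lemma local_fexp p x y n : component p -> p ** x = p ** y ->
  p ** fexp x n = p ** fexp y n.
Proof.
move=> cp xy; elim: n => // n IH; rewrite /fexp !iterS -!/(fexp _ n).
by rewrite fmulA xy (comp_central cp y) -fmulA IH fmulA -(comp_central cp y) -fmulA.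
Qed.

Lemma local_power_series c coef : local_series (power_series c coef).
Proof.
move=> q n x y cq xy; rewrite /power_series !fmulA !(comp_central cq (coef n)) -!fmulA.
by rewrite (@local_fexp q (x - c) (y - c) n cq)// !fmulBr xy.
Qed.

Lemma local_integrated_power_series c coef : local_series (integrated_power_series c coef).
Proof.
move=> q n x y cq xy; rewrite /integrated_power_series.
rewrite !fmulA !(comp_central cq (_ *: coef n)) -!fmulA.
by rewrite (@local_fexp q (x - c) (y - c) n.+1 cq)// !fmulBr xy.
Qed.

(** At the centre all partial sums equal the term of index [0]; this supplies the nonempty spectrum
    that [le_sup_meet] requires. *)
Lemma spectrum_cvg0 (u : nat -> E -> E) c : (forall n, u n.+1 c = 0) -> spectrum_cvg u c 0.
Proof.
move=> u0; split => //; exists (u 0%N), (fun=> 0).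
  split=> //; split=> [_ [_ _ <-]//|z]; apply; by exists 0%N.
move=> m x; rewrite in_itv /= subr0 addr0 => /le_anti <-.
rewrite /partial_sum big_ord_recl big1 /= => [|i _]; last exact: u0.
by rewrite addr0 subrr vabs0.
Qed.

Lemma fexp0S n : fexp (0 : E) n.+1 = 0.
Proof. by rewrite /fexp iterS fmul0l. Qed.

Lemma spectrum_power_series0 c coef : spectrum_cvg (power_series c coef) c 0.
Proof.
by apply: spectrum_cvg0 => n; rewrite /power_series subrr fexp0S fmul0r.
Qed.

Lemma spectrum_integrated_power_series0 c coef :
  spectrum_cvg (integrated_power_series c coef) c 0.
Proof.
by apply: spectrum_cvg0 => n; rewrite /integrated_power_series subrr fexp0S fmul0r.
Qed.

Lemma fexp_ge0 d n : 0 <= d -> 0 <= fexp d n.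
Proof.
move=> d0; elim: n => [|n IH]; first exact: fone_ge0.
by rewrite /fexp iterS fmul_ge0.
Qed.

Lemma fexpS x n : fexp x n.+1 = x ** fexp x n. Proof. by []. Qed.

Lemma vabsM_le x y a b : vabs x <= a -> vabs y <= b -> vabs (x ** y) <= a ** b.
Proof.
move=> xa yb; apply: (le_trans (vabsM _ _)); apply: fmul_le => //.
  exact: vabs_ge0.
exact: le_trans (vabs_ge0 y) yb.
Qed.

Lemma vabsD_le x y a b : vabs x <= a -> vabs y <= b -> vabs (x + y) <= a + b.
Proof.
move=> xa yb; apply: (le_trans (vabsD _ _)).
by apply: (vle2 xa yb); linear_eq.
Qed.

Lemma fexp_bound z d n : vabs z <= d -> vabs (fexp z n) <= fexp d n.
Proof.
move=> zd; elim: n => [|n IH]; first by rewrite /fexp /= vabs_id// fone_ge0.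
by rewrite !fexpS; exact: vabsM_le.
Qed.

(** Unfolding the recursion for [K] gives the usual constant [n d^(n-1)]. *)
Lemma fexp_lipschitz d n : 0 <= d -> exists2 K, 0 <= K & forall x y,
  vabs x <= d -> vabs y <= d -> vabs (fexp y n - fexp x n) <= K ** vabs (y - x).
Proof.
move=> d0; elim: n => [|n [K K0 IH]].
  by exists 0 => // x y _ _; rewrite subrr vabs0 fmul0l.
exists (d ** K + fexp d n) => [|x y xd yd].
  by rewrite vaddr_ge0 ?fmul_ge0 ?fexp_ge0.
have -> : fexp y n.+1 - fexp x n.+1 = y ** (fexp y n - fexp x n) + fexp x n ** (y - x).
  rewrite !fexpS; fring_eq Ecomp.
rewrite fmulDl -fmulA; apply: vabsD_le; apply: vabsM_le => //.
  exact: IH.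
exact: fexp_bound.
Qed.

Lemma vabs_sq x : vabs (x ** x) = x ** x.
Proof. by rewrite vabs_id// fsq_ge0. Qed.

(** Passing from [n] to [n + 1] multiplies the remainder by [y] and adds [(n + 1) x^n (y - x)^2]. *)
Lemma fexp_taylor d n : 0 <= d -> exists2 K, 0 <= K & forall x y,
  vabs x <= d -> vabs y <= d ->
  vabs (fexp y n.+1 - fexp x n.+1 - n.+1%:R *: (fexp x n ** (y - x))) <=
    K ** ((y - x) ** (y - x)).
Proof.
move=> d0; elim: n => [|n [K K0 IH]].
  exists 0 => // x y _ _; rewrite !fexpS /fexp /= !fmul1r scale1r fmul1l subrr.
  by rewrite vabs0 fmul0l.
have n0 : (0 : R) <= n.+1%:R by [].
exists (d ** K + n.+1%:R *: fexp d n) => [|x y xd yd].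
  by rewrite vaddr_ge0 ?vscale_ge0 ?fmul_ge0 ?fexp_ge0.
have -> : fexp y n.+2 - fexp x n.+2 - n.+2%:R *: (fexp x n.+1 ** (y - x)) =
    y ** (fexp y n.+1 - fexp x n.+1 - n.+1%:R *: (fexp x n ** (y - x))) +
    (n.+1%:R *: fexp x n) ** ((y - x) ** (y - x)).
  have -> : n.+2%:R *: (fexp x n.+1 ** (y - x)) =
      n.+1%:R *: (fexp x n.+1 ** (y - x)) + fexp x n.+1 ** (y - x).
    by rewrite -[n.+2%:R]natr1; linear_eq.
  rewrite (fscale_one _ (fexp x n.+1 ** _)) (fscale_one _ (fexp x n ** _)).
  rewrite (fscale_one _ (fexp x n)); set k := n.+1%:R *: fone.
  rewrite [fexp y n.+2]fexpS [fexp x n.+2]fexpS [fexp x n.+1]fexpS.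
  set Y := fexp y n.+1; set W := fexp x n.
  fring_eq Ecomp.
rewrite [X in _ <= X]fmulDl -[d ** K ** _]fmulA; apply: vabsD_le; apply: vabsM_le => //.
- exact: IH.
- by apply: (le_trans (vabsZ _ _)) => //; apply: vle_scale => //; exact: fexp_bound.
- by rewrite vabs_sq.
Qed.

(** * Lipschitz and Taylor estimates for partial sums *)

Section Estimates.
Variables (c d : E) (coef : nat -> E).
Hypothesis d0 : 0 <= d.

Lemma itv_abs x : c - d <= x <= c + d -> vabs (x - c) <= d.
Proof.
move=> /andP[x1 x2]; apply: vabs_le.
  by apply: (vle1 x2); linear_eq.
by apply: (vle1 x1); linear_eq.
Qed.

Lemma partial_sumS (u : nat -> E -> E) m x :
  partial_sum u m.+1 x = partial_sum u m x + u m.+1 x.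
Proof. by rewrite /partial_sum big_ord_recr. Qed.

Lemma partial_sum0 (u : nat -> E -> E) x : partial_sum u 0 x = u 0%N x.
Proof. by rewrite /partial_sum big_ord_recr big_ord0 /= add0r. Qed.

Lemma partial_sum_lipschitz m : exists2 K, 0 <= K & forall x y,
  c - d <= x <= c + d -> c - d <= y <= c + d ->
  vabs (partial_sum (power_series c coef) m y - partial_sum (power_series c coef) m x)
    <= K ** vabs (y - x).
Proof.
have term n : exists2 K, 0 <= K & forall x y,
    c - d <= x <= c + d -> c - d <= y <= c + d ->
    vabs (power_series c coef n y - power_series c coef n x) <= K ** vabs (y - x).
  have [K K0 hK] := fexp_lipschitz n d0.
  exists (vabs (coef n) ** K) => [|x y xd yd]; first by rewrite fmul_ge0// vabs_ge0.
  rewrite /power_series -fmulBr -fmulA; apply: vabsM_le => //.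
  have -> : y - x = (y - c) - (x - c) by linear_eq.
  by apply: hK; exact: itv_abs.
elim: m => [|m [K K0 IH]].
  have [K K0 hK] := term 0%N; exists K => // x y xd yd.
  by rewrite !partial_sum0; exact: hK.
have [L L0 hL] := term m.+1.
exists (K + L) => [|x y xd yd]; first exact: vaddr_ge0.
rewrite !partial_sumS fmulDl.
set A := partial_sum _ m y; set B := partial_sum _ m x.
set A' := power_series _ _ _ y; set B' := power_series _ _ _ x.
have -> : A + A' - (B + B') = (A - B) + (A' - B') by linear_eq.
by apply: vabsD_le; [exact: IH|exact: hL].
Qed.

(** Termwise, the factor [n.+1%:R^-1] of the integrated series cancels the [n.+1%:R] of
    [fexp_taylor]. *)
Lemma partial_sum_taylor m : exists2 K, 0 <= K & forall x y,
  c - d <= x <= c + d -> c - d <= y <= c + d ->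
  vabs (partial_sum (integrated_power_series c coef) m y -
        partial_sum (integrated_power_series c coef) m x -
        partial_sum (power_series c coef) m x ** (y - x))
    <= K ** ((y - x) ** (y - x)).
Proof.
have term n : exists2 K, 0 <= K & forall x y,
    c - d <= x <= c + d -> c - d <= y <= c + d ->
    vabs (integrated_power_series c coef n y - integrated_power_series c coef n x
          - power_series c coef n x ** (y - x)) <= K ** ((y - x) ** (y - x)).
  have [K K0 hK] := fexp_taylor n d0.
  exists (vabs (n.+1%:R^-1 *: coef n) ** K) => [|x y xd yd].
    by rewrite fmul_ge0// vabs_ge0.
  rewrite /power_series /integrated_power_series.
  have := hK _ _ (itv_abs xd) (itv_abs yd).
  have -> : (y - c) - (x - c) = y - x by linear_eq.
  move=> h; rewrite -[vabs _ ** K ** _]fmulA.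
  have -> : coef n ** fexp (x - c) n ** (y - x) =
      (n.+1%:R^-1 *: coef n) ** (n.+1%:R *: (fexp (x - c) n ** (y - x))).
    by rewrite fmulZl fmulZr scalerA mulVf ?pnatr_eq0// scale1r fmulA.
  by rewrite -!fmulBr; apply: vabsM_le.
elim: m => [|m [K K0 IH]].
  have [K K0 hK] := term 0%N; exists K => // x y xd yd.
  by rewrite !partial_sum0; exact: hK.
have [L L0 hL] := term m.+1.
exists (K + L) => [|x y xd yd]; first exact: vaddr_ge0.
rewrite !partial_sumS [X in _ <= X]fmulDl.
set A := partial_sum _ m y; set B := partial_sum _ m x; set C := partial_sum _ m x.
set A' := integrated_power_series _ _ _ y; set B' := integrated_power_series _ _ _ x.
set C' := power_series _ _ _ x.
have -> : A + A' - (B + B') - (C + C') ** (y - x) =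
  (A - B - C ** (y - x)) + (A' - B' - C' ** (y - x)) by rewrite [(C + C') ** _]fmulDl; linear_eq.
by apply: vabsD_le; [exact: IH|exact: hL].
Qed.

End Estimates.

(** With [n + 1] equal steps [h = w / (n + 1)], each step adds at most [M h + K h^2], in total
    [M w + K w^2 / (n + 1)]. *)
Lemma mean_value_le (F f : E -> E) x y K M : x <= y -> 0 <= K ->
  (forall s t, x <= s <= y -> x <= t <= y ->
     vabs (F t - F s - f s ** (t - s)) <= K ** ((t - s) ** (t - s))) ->
  (forall s, x <= s <= y -> f s <= M) ->
  F y - F x <= M ** (y - x).
Proof.
move=> xy K0 hF hM; set w := y - x; have w0 : 0 <= w by rewrite vsubr_ge0.
suff h : F y - F x - M ** w <= 0 by apply: (vle1 h); linear_eq.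
apply: (@arch_inv_le0 _ _ Ecomp _ (K ** (w ** w))) => n.
pose N : R := n.+1%:R; have N0 : 0 <= N by [].
have Nn0 : N != 0 by rewrite pnatr_eq0.
have NV0 : 0 <= N^-1 by rewrite invr_ge0.
pose h := N^-1 *: w; have h0 : 0 <= h by exact: vscale_ge0.
have NhE : N *: h = w by rewrite /h scalerA mulfV// scale1r.
pose t k : E := x + k%:R *: h.
have tx k : (k <= n.+1)%N -> x <= t k <= y.
  move=> kn; apply/andP; split.
    by have := vscale_ge0 (ler0n R k) h0 => h1; apply: (vle1 h1); rewrite /t; linear_eq.
  have h1 : k%:R *: h <= N *: h by apply: vscale_leW => //; rewrite ler_nat.
  rewrite NhE in h1.
  by apply: (vle1 h1); rewrite /t /w; linear_eq.
have step k : (k <= n.+1)%N -> F (t k) - F x <= k%:R *: (M ** h + K ** (h ** h)).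
  elim: k => [_|k IH kn].
    by rewrite /t !scale0r addr0 subrr.
  have kn' := ltnW kn.
  have e : t k.+1 - t k = h by rewrite /t -natr1; linear_eq.
  have h1 := le_trans (vabs_ge _) (hF _ _ (tx k kn') (tx k.+1 kn)).
  rewrite e in h1.
  have h2 := fmul_ler h0 (hM _ (tx k kn')).
  by apply: (vle3 h1 h2 (IH kn')); rewrite -natr1; linear_eq.
have tN : t n.+1 = y by rewrite /t NhE /w; linear_eq.
have hhE : N *: (h ** h) = N^-1 *: (w ** w).
  by rewrite -fmulZl NhE /h fmulZr.
have := step n.+1 (leqnn _); rewrite tN -/N scalerDr.
rewrite -[N *: (M ** h)]fmulZr -[N *: (K ** _)]fmulZr NhE hhE fmulZr => h1.
by apply: (vle1 h1); linear_eq.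
Qed.

Lemma mean_value_ge (F f : E -> E) x y K M : x <= y -> 0 <= K ->
  (forall s t, x <= s <= y -> x <= t <= y ->
     vabs (F t - F s - f s ** (t - s)) <= K ** ((t - s) ** (t - s))) ->
  (forall s, x <= s <= y -> M <= f s) ->
  M ** (y - x) <= F y - F x.
Proof.
move=> xy K0 hF hM.
have := @mean_value_le (fun s => - F s) (fun s => - f s) x y K (- M) xy K0 _ _.
rewrite fmulNl => h; have {}h : - F y - - F x <= - (M ** (y - x)).
  apply: h => [s t hs ht|s /hM h]; last by apply: (vle1 h); linear_eq.
  have -> : - F t - - F s - - f s ** (t - s) = - (F t - F s - f s ** (t - s)).
    by rewrite fmulNl; linear_eq.
  by rewrite vabsN; exact: hF.
by apply: (vle1 h); linear_eq.
Qed.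

Lemma dec_add (P Q : nat -> E) : decreases_to0 P -> decreases_to0 Q ->
  decreases_to0 (fun m => P m + Q m).
Proof.
move=> dP dQ; have [P1 P2] := dP; have [Q1 Q2] := dQ; split.
  by move=> m; apply: (vle2 (P1 m) (Q1 m)); linear_eq.
split=> [_ [m _ <-]|z hz]; first by rewrite vaddr_ge0// dec_ge0.
apply: (dec_inf dP) => m.
suff h : z - P m <= 0 by apply: (vle1 h); linear_eq.
apply: (dec_inf dQ) => n.
have h1 : z <= P (m + n)%N + Q (m + n)%N by apply: hz; exists (m + n)%N.
have h2 := dec_mono m n dP; have h3 := dec_mono n m dQ; rewrite addnC in h3.
by apply: (vle3 h1 h2 h3); linear_eq.
Qed.

(** * Integration on a common interval of uniform convergence *)

Section Integral.
Variables (c d : E) (coef : nat -> E).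
Hypothesis d_f : spectrum_cvg (power_series c coef) c d.
Hypothesis d_g : spectrum_cvg (integrated_power_series c coef) c d.
Let fm := partial_sum (power_series c coef).
Let gm := partial_sum (integrated_power_series c coef).
Let f := series_fun (power_series c coef).
Let g := series_fun (integrated_power_series c coef).

Let d0 : 0 <= d. Proof. by case: d_f. Qed.

Lemma uniform_estimate : exists2 T : nat -> E, decreases_to0 T &
  forall m x, c - d <= x <= c + d ->
    vabs (fm m x - f x) <= T m /\ vabs (gm m x - g x) <= T m.
Proof.
have [P dP hP] := spectrum_fun d_f; have [Q dQ hQ] := spectrum_fun d_g.
exists (fun m => P m + Q m); first exact: dec_add.
move=> m x xd; have [_ h1] := hP x xd; have [_ h2] := hQ x xd.
have P0 := dec_ge0 m dP; have Q0 := dec_ge0 m dQ; split.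
  by apply: (vle2 (h1 m) Q0); linear_eq.
by apply: (vle2 (h2 m) P0); linear_eq.
Qed.

Lemma vabs_lr x y : vabs x <= y -> x <= y /\ - x <= y.
Proof. by rewrite /vabs le_vjoin => /andP. Qed.

Lemma sub_itv x y z : c - d <= x -> y <= c + d -> x <= z <= y -> c - d <= z <= c + d.
Proof. by move=> cx yc /andP[xz zy]; rewrite (le_trans cx xz) (le_trans zy yc). Qed.

Lemma integral_mean_le x y M : c - d <= x -> y <= c + d -> x <= y ->
  (forall s, x <= s <= y -> f s <= M) -> g y - g x <= M ** (y - x).
Proof.
move=> cx yc xy hM; have [T dT hT] := uniform_estimate.
suff h : g y - g x - M ** (y - x) <= 0 by apply: (vle1 h); linear_eq.
(* The weight of [T m]: [y - x] from bounding the partial sum of [f] by [M + T m], and [2] from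
   replacing that of [g] by [g] at both ends. *)
have w0 : 0 <= y - x + 2 *: fone.
  by rewrite vaddr_ge0 ?vsubr_ge0// vscale_ge0// fone_ge0.
apply: (dec_mul_le0 Ecomp dT w0) => m.
have [K K0 hK] := partial_sum_taylor c coef d0 m.
have h1 : gm m y - gm m x <= (M + T m) ** (y - x).
  apply: (@mean_value_le _ (fm m) _ _ K _ xy K0) => [s t hs ht|s hs].
    by apply: hK; apply: sub_itv; eassumption.
  have [/vabs_lr[h _] _] := hT m s (sub_itv cx yc hs).
  by apply: (vle2 h (hM s hs)); linear_eq.
have yI : x <= y <= y by rewrite xy lexx.
have xI : x <= x <= y by rewrite xy lexx.
have [_ /vabs_lr[_ h2]] := hT m y (sub_itv cx yc yI).
have [_ /vabs_lr[h3 _]] := hT m x (sub_itv cx yc xI).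
rewrite fmulDl in h1; rewrite [T m ** _]fmulDr fmulZr fmul1r.
by apply: (vle3 h1 h2 h3); linear_eq.
Qed.

Lemma integral_mean_ge x y M : c - d <= x -> y <= c + d -> x <= y ->
  (forall s, x <= s <= y -> M <= f s) -> M ** (y - x) <= g y - g x.
Proof.
move=> cx yc xy hM; have [T dT hT] := uniform_estimate.
suff h : M ** (y - x) - (g y - g x) <= 0 by apply: (vle1 h); linear_eq.
have w0 : 0 <= y - x + 2 *: fone.
  by rewrite vaddr_ge0 ?vsubr_ge0// vscale_ge0// fone_ge0.
apply: (dec_mul_le0 Ecomp dT w0) => m.
have [K K0 hK] := partial_sum_taylor c coef d0 m.
have h1 : (M - T m) ** (y - x) <= gm m y - gm m x.
  apply: (@mean_value_ge _ (fm m) _ _ K _ xy K0) => [s t hs ht|s hs].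
    by apply: hK; apply: sub_itv; eassumption.
  have [/vabs_lr[_ h] _] := hT m s (sub_itv cx yc hs).
  by apply: (vle2 h (hM s hs)); linear_eq.
have yI : x <= y <= y by rewrite xy lexx.
have xI : x <= x <= y by rewrite xy lexx.
have [_ /vabs_lr[h2 _]] := hT m y (sub_itv cx yc yI).
have [_ /vabs_lr[_ h3]] := hT m x (sub_itv cx yc xI).
rewrite fmulBl in h1; rewrite [T m ** _]fmulDr fmulZr fmul1r.
by apply: (vle3 h1 h2 h3); linear_eq.
Qed.

Lemma dom_f x : c - d <= x <= c + d -> series_dom (power_series c coef) x.
Proof. by have [P _ hP] := spectrum_fun d_f; move=> /hP[]. Qed.

Lemma dom_g x : c - d <= x <= c + d -> series_dom (integrated_power_series c coef) x.
Proof. by have [P _ hP] := spectrum_fun d_g; move=> /hP[]. Qed.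

Lemma local_limit (u : nat -> E -> E) q x y : local_series u -> spectrum_cvg u c d ->
  component q -> c - d <= x <= c + d -> c - d <= y <= c + d ->
  q ** x = q ** y -> q ** series_fun u x = q ** series_fun u y.
Proof.
move=> lu du cq xd yd xy; have [T dT hT] := spectrum_fun du; have q0 := comp_ge0 cq.
apply/eqP; rewrite -subr_eq0 -fmulBr; apply/eqP/vabs_eq0/le_anti.
rewrite vabs_ge0 andbT -fmul_abs//.
have w0 : 0 <= 2 *: fone :> E by rewrite vscale_ge0// fone_ge0.
apply: (dec_mul_le0 Ecomp dT w0) => m; rewrite fmulZr fmul1r.
have [_ hx] := hT x xd; have [_ hy] := hT y yd.
have e : q ** (series_fun u x - series_fun u y) =
    q ** (partial_sum u m y - series_fun u y - (partial_sum u m x - series_fun u x)).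
  by rewrite !fmulBr (local_partial_sum m lu cq xy); linear_eq.
rewrite fmul_abs// e -fmul_abs//.
apply: (le_trans (comp_mull_le cq (vabs_ge0 _))).
apply: (le_trans (vabsD _ _)); rewrite vabsN.
by apply: (vle2 (hx m) (hy m)); linear_eq.
Qed.

(** The partial sum of index [0] is constant, and [f] stays within [T 0] of it. *)
Lemma power_series_bounded : exists2 M, 0 <= M &
  forall x, c - d <= x <= c + d -> vabs (f x) <= M.
Proof.
have [T dT hT] := uniform_estimate; have T0 := dec_ge0 0 dT.
exists (vabs (coef 0%N) + T 0%N) => [|x /(hT 0%N)[h _]].
  by rewrite vaddr_ge0 ?vabs_ge0.
have -> : f x = coef 0%N - (fm 0 x - f x).
  by rewrite /fm partial_sum0 /power_series /fexp /= fmul1r; linear_eq.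
by apply: vabsD_le; rewrite ?vabsN.
Qed.

(** [K] depends on [m], so this is not a Lipschitz bound for [f]: the error [2 *: T m] must be
    removed after the mesh has been refined. *)
Lemma power_series_osc : exists2 T : nat -> E, decreases_to0 T &
  forall m, exists2 K, 0 <= K & forall x y, c - d <= x <= c + d -> c - d <= y <= c + d ->
    f y - f x <= K ** vabs (y - x) + 2 *: T m.
Proof.
have [T dT hT] := uniform_estimate; exists T => // m.
have [K K0 hK] := partial_sum_lipschitz c coef d0 m.
exists K => // x y xd yd.
have [/vabs_lr[h1 _] _] := hT m x xd; have [/vabs_lr[_ h2] _] := hT m y yd.
have [h3 _] := vabs_lr (hK x y xd yd).
by apply: (vle3 h1 h2 h3); rewrite -!/(fm _ _); linear_eq.
Qed.

Lemma mem_itvE x y z : `[x, y]%classic z <-> x <= z <= y.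
Proof. by rewrite /= in_itv. Qed.

Lemma infimum_f x y : c - d <= x -> y <= c + d -> x <= y ->
  infimums (f @` `[x, y]%classic) (infimum 0 (f @` `[x, y]%classic)).
Proof.
move=> cx yc xy; have [M M0 hM] := power_series_bounded.
have ne : f @` `[x, y]%classic !=set0.
  by exists (f x); exists x => //; apply/mem_itvE; rewrite lexx.
have [||s hs] := @dedekind_inf _ _ Ecomp (f @` `[x, y]%classic) => //;
  last by rewrite (infimumE _ hs).
exists (- M) => _ [z /mem_itvE zxy <-].
have [_ h] := vabs_lr (hM z (sub_itv cx yc zxy)).
by apply: (vle1 h); linear_eq.
Qed.

Lemma supremum_f x y : c - d <= x -> y <= c + d -> x <= y ->
  supremums (f @` `[x, y]%classic) (supremum 0 (f @` `[x, y]%classic)).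
Proof.
move=> cx yc xy; have [M M0 hM] := power_series_bounded.
have ne : f @` `[x, y]%classic !=set0.
  by exists (f x); exists x => //; apply/mem_itvE; rewrite lexx.
have [||s hs] := @dedekind_sup _ _ Ecomp (f @` `[x, y]%classic) => //;
  last by rewrite (supremumE _ hs).
exists M => _ [z /mem_itvE zxy <-].
by have [h _] := vabs_lr (hM z (sub_itv cx yc zxy)).
Qed.

Lemma path_le_last p (s : seq E) : path <=%R p s -> p <= last p s.
Proof.
elim: s p => //= x s IH p /andP[px /IH]; exact: le_trans.
Qed.

Lemma lower_sum_cons p x (s : seq E) : lower_sum f p (x :: s) =
  infimum 0 (f @` `[p, x]%classic) ** (x - p) + lower_sum f x s.
Proof. by rewrite /lower_sum /= big_ord_recl. Qed.

Lemma upper_sum_cons p x (s : seq E) : upper_sum f p (x :: s) =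
  supremum 0 (f @` `[p, x]%classic) ** (x - p) + upper_sum f x s.
Proof. by rewrite /upper_sum /= big_ord_recl. Qed.

Lemma lower_sum_nil p : lower_sum f p [::] = 0.
Proof. by rewrite /lower_sum big_ord0. Qed.

Lemma upper_sum_nil p : upper_sum f p [::] = 0.
Proof. by rewrite /upper_sum big_ord0. Qed.

Lemma sums_bracket p q (s : seq E) : c - d <= p -> q <= c + d -> is_partition p q s ->
  lower_sum f p s <= g q - g p <= upper_sum f p s.
Proof.
elim: s p => [|x s IH] p cp qc.
  by case/andP => _ /= /eqP ->; rewrite lower_sum_nil upper_sum_nil subrr lexx.
case/andP => /= /andP[px xs] /eqP xq.
have xq' : x <= q by rewrite -xq path_le_last.
have cx := le_trans cp px; have xc := le_trans xq' qc.
have /andP[h1 h2] : lower_sum f x s <= g q - g x <= upper_sum f x s.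
  by apply: IH => //; rewrite /is_partition xs xq eqxx.
rewrite lower_sum_cons upper_sum_cons; apply/andP; split.
  have h : infimum 0 (f @` `[p, x]%classic) ** (x - p) <= g x - g p.
    apply: integral_mean_ge => // z pzx.
    apply: (inf_lb (infimum_f cp xc px)); exists z => //; exact/mem_itvE.
  by apply: (vle2 h1 h); linear_eq.
have h : g x - g p <= supremum 0 (f @` `[p, x]%classic) ** (x - p).
  apply: integral_mean_le => // z pzx.
  apply: (sup_ub (supremum_f cp xc px)); exists z => //; exact/mem_itvE.
by apply: (vle2 h2 h); linear_eq.
Qed.

(** Each of the [n] cells has width [h] and oscillation at most [K ** h + t]. The list starts at
    [h + p] because the encoding of a partition omits its first point. *)
Lemma uniform_sums_gap p h K t (n : nat) : c - d <= p -> 0 <= h -> 0 <= K ->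
  p + n%:R *: h <= c + d ->
  (forall x y, c - d <= x <= c + d -> c - d <= y <= c + d ->
    f y - f x <= K ** vabs (y - x) + t) ->
  let s := traject (+%R h) (h + p) n in
  upper_sum f p s - lower_sum f p s <= n%:R *: ((K ** h + t) ** h).
Proof.
move=> cp h0 K0 + osc; elim: n p cp => [|n IH] p cp pn /=.
  by rewrite upper_sum_nil lower_sum_nil subrr scale0r.
rewrite upper_sum_cons lower_sum_cons.
have px : p <= h + p by apply: (vle1 h0); linear_eq.
have nh : 0 <= n%:R *: h by exact: vscale_ge0.
have xc : h + p <= c + d by apply: (vle2 pn nh); rewrite -natr1; linear_eq.
have hI : upper_sum f (h + p) (traject (+%R h) (h + (h + p)) n) -
    lower_sum f (h + p) (traject (+%R h) (h + (h + p)) n) <=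
    n%:R *: ((K ** h + t) ** h).
  apply: IH; first exact: le_trans px.
  by apply: (vle1 pn); rewrite -natr1; linear_eq.
set U := supremum _ _; set L := infimum _ _.
have UL : U - L <= K ** h + t.
  suff hU : U <= L + (K ** h + t) by apply: (vle1 hU); linear_eq.
  apply: (sup_lub (supremum_f cp xc px)) => _ [y /mem_itvE yI <-].
  suff hL : f y - (K ** h + t) <= L by apply: (vle1 hL); linear_eq.
  apply: (inf_glb (infimum_f cp xc px)) => _ [x /mem_itvE xI <-].
  have h1 := osc x y (sub_itv cp xc xI) (sub_itv cp xc yI).
  have h2 : vabs (y - x) <= h.
    case/andP: xI => x1 x2; case/andP: yI => y1 y2; apply: vabs_le.
      by apply: (vle2 x1 y2); linear_eq.
    by apply: (vle2 y1 x2); linear_eq.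
  by apply: (vle2 h1 (fmul_lel K0 h2)); linear_eq.
have h3 := fmul_ler h0 UL; rewrite fmulBl in h3.
have -> : h + p - p = h by linear_eq.
by apply: (vle2 h3 hI); rewrite -natr1; linear_eq.
Qed.

Lemma uniform_partition p h n : 0 <= h ->
  is_partition p (p + n%:R *: h) (traject (+%R h) (h + p) n).
Proof.
move=> h0; rewrite /is_partition last_traject; apply/andP; split.
  apply: sub_path (fpath_traject (+%R h) p n) => x y /eqP <- /=.
  by apply: (vle1 h0); linear_eq.
apply/eqP; elim: n => [|n IH]; first by rewrite scale0r addr0.
by rewrite iterS IH -natr1; linear_eq.
Qed.

Section Bounds.
Variables p q : E.
Hypotheses (cp : c - d <= p) (qc : q <= c + d) (pq : p <= q).

(* The gaps of the uniform partitions are bounded by the infinitesimal quantities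
   [K w^2 / n + 2 T_m w] with [w = q - p]. *)
Lemma sums_gap_le0 z :
  (forall s : seq E, is_partition p q s -> z <= upper_sum f p s - lower_sum f p s) -> z <= 0.
Proof.
move=> hz; have [T dT hT] := power_series_osc.
set w := q - p; have w0 : 0 <= w by rewrite vsubr_ge0.
have w20 : 0 <= 2 *: w by exact: vscale_ge0.
(* [m] is fixed before [n], since [K] depends on [m]. *)
apply: (dec_mul_le0 Ecomp dT w20) => m; have [K K0 hK] := hT m.
suff h : z - T m ** (2 *: w) <= 0 by apply: (vle1 h); linear_eq.
apply: (@arch_inv_le0 _ _ Ecomp _ (K ** (w ** w))) => n.
have Nn0 : n.+1%:R != 0 :> R by rewrite pnatr_eq0.
have NV0 : 0 <= n.+1%:R^-1 :> R by rewrite invr_ge0.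
pose h := n.+1%:R^-1 *: w; have h0 : 0 <= h by exact: vscale_ge0.
have NhE : n.+1%:R *: h = w by rewrite /h scalerA mulfV// scale1r.
have qE : p + n.+1%:R *: h = q by rewrite NhE /w; linear_eq.
have hp := @uniform_partition p h n.+1 h0; rewrite qE in hp.
have := @uniform_sums_gap p h K (2 *: T m) n.+1 cp h0 K0; rewrite qE => /(_ qc hK) hgap.
have gapE : n.+1%:R *: ((K ** h + 2 *: T m) ** h) =
    n.+1%:R^-1 *: (K ** (w ** w)) + T m ** (2 *: w).
  rewrite -[LHS]fmulZr NhE [LHS]fmulDl /h [K ** _]fmulZr [_ ** w in LHS]fmulZl.
  by rewrite [(2 *: _) ** _]fmulZl [T m ** (2 *: w)]fmulZr -fmulA.
rewrite gapE in hgap.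
by apply: (vle1 (le_trans (hz _ hp) hgap)); linear_eq.
Qed.

Lemma lower_sums_sup : supremums (lower_sums f p q) (g q - g p).
Proof.
split=> [_ [s hs <-]|y hy]; first by have /andP[] := sums_bracket cp qc hs.
suff h : g q - g p - y <= 0 by apply: (vle1 h); linear_eq.
apply: sums_gap_le0 => s hs; have /andP[_ h1] := sums_bracket cp qc hs.
have h2 : lower_sum f p s <= y by apply: hy; exists s.
by apply: (vle2 h1 h2); linear_eq.
Qed.

Lemma upper_sums_inf : infimums (upper_sums f p q) (g q - g p).
Proof.
split=> [_ [s hs <-]|y hy]; first by have /andP[] := sums_bracket cp qc hs.
suff h : y - (g q - g p) <= 0 by apply: (vle1 h); linear_eq.
apply: sums_gap_le0 => s hs; have /andP[h1 _] := sums_bracket cp qc hs.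
have h2 : y <= upper_sum f p s by apply: hy; exists s.
by apply: (vle2 h1 h2); linear_eq.
Qed.

Lemma power_series_integrable :
  riemann_integrable (series_dom (power_series c coef)) f p q.
Proof.
have pqd z : `[p, q]%classic z -> c - d <= z <= c + d.
  by move=> /mem_itvE; exact: sub_itv.
split=> //.
- by move=> z /pqd; exact: dom_f.
- move=> P /(band_projectionE Ecomp)[r cr hP] x y /pqd xd /pqd yd.
  by rewrite !hP; apply: local_limit => //; exact: local_power_series.
- have [M M0 hM] := power_series_bounded; exists M => // x /pqd; exact: hM.
- by exists (g q - g p); [exact: lower_sums_sup|exact: upper_sums_inf].
Qed.

Lemma power_series_ordered_integral : ordered_integral f p q = g q - g p.
Proof.
apply: supremumE; first exact: lower_sums_sup.
have w0 : 0 <= q - p by rewrite vsubr_ge0.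
(* The one-step partition shows that there are lower sums at all. *)
have := uniform_partition p 1 w0; rewrite scale1r (_ : p + (q - p) = q); last by linear_eq.
by move=> h; eexists; eexists; first exact: h.
Qed.

End Bounds.

Lemma proj_lt_comp a b : exists r, [/\ component r, forall x, proj_lt a b x = r ** x,
  r ** vpos (b - a) = vpos (b - a) & forall x, vmeet (vpos (b - a)) x = 0 -> r ** x = 0].
Proof.
have [r [cr rw rd]] := support_ex Ecomp (vpos_ge0 (b - a)).
exists r; split=> // x.
by rewrite /proj_lt (band_gen_comp Ecomp cr rw (vpos_ge0 _) rd) band_proj_comp.
Qed.

(** On the support of [(b - a)^+] the meet is [a] and the join is [b]; on that of [(a - b)^+] they
    are interchanged; off both, [a = b]. Locality of [g] transfers each case to the values of
    [g]. *)
Lemma power_series_riemann_integral a b :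
  c - d <= a <= c + d -> c - d <= b <= c + d ->
  riemann_integral f a b = g b - g a.
Proof.
move=> ad bd; set m := vmeet a b; set j := vjoin a b.
have md : c - d <= m <= c + d.
  move/andP: (ad) => [a1 a2]; move/andP: (bd) => [b1 b2].
  by rewrite vmeet_glb//=; exact: le_trans (vmeetl _ _) a2.
have jd : c - d <= j <= c + d.
  move/andP: (ad) => [a1 a2]; move/andP: (bd) => [b1 b2].
  by rewrite vjoin_lub// andbT; exact: le_trans a1 (vjoinl _ _).
have mj : m <= j by exact: le_trans (vmeetl _ _) (vjoinl _ _).
have [m1 _] := andP md; have [_ j2] := andP jd.
rewrite /riemann_integral -/m -/j power_series_ordered_integral//.
have gl q x y : component q -> c - d <= x <= c + d -> c - d <= y <= c + d ->
    q ** x = q ** y -> q ** g x = q ** g y.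
  by apply: local_limit => //; exact: local_integrated_power_series.
have eN : a - b = - (b - a) by linear_eq.
have [r1 [c1 P1 p1 z1]] := proj_lt_comp a b.
have [r2 [c2 P2 p2 z2]] := proj_lt_comp b a; rewrite eN vposN in p2 z2.
have n1 : r1 ** vneg (b - a) = 0 by apply: z1; exact: vpos_neg_disj.
have n2 : r2 ** vpos (b - a) = 0 by apply: z2; rewrite vmeetC; exact: vpos_neg_disj.
have r21 : r2 ** r1 = 0.
  by apply: z2; rewrite vmeetC; apply: comp_mul0_disj => //; exact: vneg_ge0.
have mE : a - m = vneg (b - a) by rewrite vsub_meetE eN vposN.
have mE' : b - m = vpos (b - a) by rewrite /m vmeetC vsub_meetE.
have jE : j = a + b - m by rewrite -(vmeet_join a b) -/m -/j; linear_eq.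
have r1m : r1 ** m = r1 ** a.
  by apply/esym/eqP; rewrite -subr_eq0 -fmulBr mE n1.
have r2m : r2 ** m = r2 ** b.
  by apply/esym/eqP; rewrite -subr_eq0 -fmulBr mE' n2.
have r1j : r1 ** j = r1 ** b by rewrite jE fmulBr fmulDr r1m; linear_eq.
have r2j : r2 ** j = r2 ** a by rewrite jE fmulBr fmulDr r2m; linear_eq.
rewrite P1 P2 !fmulBr (gl _ _ _ c1 jd bd r1j) (gl _ _ _ c1 md ad r1m).
rewrite (gl _ _ _ c2 jd ad r2j) (gl _ _ _ c2 md bd r2m).
have cr := comp_mul (comp_compl c2) (comp_compl c1).
have crE x : ((fone - r2) ** (fone - r1)) ** x = x - r2 ** x - r1 ** x.
  by rewrite fmulBl !fmulBr !fmul1l fmul1r r21 !fmulBl fmul1l fmul0l; linear_eq.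
have : ((fone - r2) ** (fone - r1)) ** g a = ((fone - r2) ** (fone - r1)) ** g b.
  apply: gl => //; apply/eqP; rewrite -subr_eq0 -fmulBr crE; apply/eqP.
  have -> : a - b = vneg (b - a) - vpos (b - a).
    by rewrite eN -[in LHS](vposBneg (b - a)); linear_eq.
  by rewrite !fmulBr n1 n2 p1 p2; linear_eq.
rewrite !crE => h.
have -> : g b - g a = (g b - r2 ** g b - r1 ** g b) - (g a - r2 ** g a - r1 ** g a)
    + (r2 ** g b + r1 ** g b - r2 ** g a - r1 ** g a) by linear_eq.
by rewrite h; linear_eq.
Qed.

End Integral.
End PowerSeries.

Theorem proposition8p4 (R : realType) (E : fAlgebraType R)
    (E_complete : universally_complete E) (S : supCompletion E)
    (c : E) (coef : nat -> E) (rho : S)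
    (rho_f : radius_cvg S (power_series c coef) c = rho)
    (rho_g : radius_cvg S (integrated_power_series c coef) c = rho)
    (rho_dom : exists r : E, [/\ 0 <= r, finvertible r & scincl S r <= rho])
    (a b : E) (ha : in_open_interval c rho a) (hb : in_open_interval c rho b) :
  let f := series_fun (power_series c coef) in
  let g := series_fun (integrated_power_series c coef) in
  [/\ riemann_integrable (series_dom (power_series c coef)) f (vmeet a b) (vjoin a b),
      series_dom (integrated_power_series c coef) a,
      series_dom (integrated_power_series c coef) b &
      riemann_integral f a b = g b - g a].
Proof.
move=> f g.
have lf := local_power_series c coef.
have lg := local_integrated_power_series c coef.
have f0 := spectrum_power_series0 c coef.
have g0 := spectrum_integrated_power_series0 c coef.
(* The join puts [a] and [b] into one interval around [c]. *)
pose d := vjoin (vabs (a - c)) (vabs (b - c)).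
have df : spectrum_cvg (power_series c coef) c d.
  by apply: (spectrum_join E_complete) => //; apply: (spectrum_open_interval E_complete _ _ rho_f).
have dg : spectrum_cvg (integrated_power_series c coef) c d.
  by apply: (spectrum_join E_complete) => //; apply: (spectrum_open_interval E_complete _ _ rho_g).
have itv x : vabs (x - c) <= d -> c - d <= x <= c + d.
  move=> /vabs_lr[h1 h2]; apply/andP; split.
    by apply: (vle1 h2); linear_eq.
  by apply: (vle1 h1); linear_eq.
have ad : c - d <= a <= c + d by apply: itv; exact: vjoinl.
have bd : c - d <= b <= c + d by apply: itv; exact: vjoinr.
have [/andP[a1 a2] /andP[b1 b2]] := (ad, bd).
split.
- have mj : vmeet a b <= vjoin a b by exact: le_trans (vmeetl _ _) (vjoinl _ _).
  by apply: (power_series_integrable E_complete df dg _ _ mj);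
    [exact: vmeet_glb|exact: vjoin_lub].
- exact: dom_g ad.
- exact: dom_g bd.
- exact: (power_series_riemann_integral E_complete df dg ad bd).
Qed.
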